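(* Let $N\ge 1$, let $\Omega\subset\mathbb{R}^N$ be a bounded domain (with at least $C^2$-smooth boundary if $N\ge 2$), and let $a\in C(\overline{\Omega})$ be sign-changing. Assume, in addition to $1<q<p$, that $$(q-1)s^p+qs^{p-1}-(p-q)s+(q-p+1)\ge 0\quad\text{for all } s\ge 0.$$ Let, moreover, one of the following assumptions be satisfied: (i) $\int_\Omega a\varphi_p^q\,dx=0$ and $\lambda>\lambda_1(p)\ (=\lambda^* )$; (ii) $\int_\Omega a\varphi_p^q\,dx>0$ and $\lambda\ge\lambda_1(p)\ (=\lambda^* )$. Then there exists no nonzero nonnegative solution $u$ of $(P_\lambda)$ such that $u>0$ in $\Omega_a^+$.
   Context: ''Sign-changing'' means that $\Omega_a^+:=\{x\in\Omega: a(x)>0\}$ and $\Omega_a^-:=\{x\in\Omega: a(x)<0\}$ are both nonempty. $W_0^{1,p}=W_0^{1,p}(\Omega)$, and $\|\cdot\|_r$ is the norm of $L^r(\Omega)$. The first eigenvalue of the Dirichlet $p$-Laplacian is $\lambda_1(p):=\inf\{\|\nabla u\|_p^p/\|u\|_p^p: u\in W_0^{1,p}\setminus\{0\}\}$, and $\varphi_p$ is the corresponding eigenfunction with $\varphi_p>0$ in $\Omega$ and $\|\nabla\varphi_p\|_p=1$. Further, $\lambda^*:=\inf\{\|\nabla u\|_p^p/\|u\|_p^p: u\in W_0^{1,p}\setminus\{0\},\ \int_\Omega a|u|^q\,dx\ge 0\}$, which coincides with $\lambda_1(p)$ when $\int_\Omega a\varphi_p^q\,dx\ge0$. $(P_\lambda)$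 is the problem $-\Delta_pu=\lambda|u|^{p-2}u+a(x)|u|^{q-2}u$ in $\Omega$, $u=0$ on $\partial\Omega$, where $\Delta_pu=\mathrm{div}(|\nabla u|^{p-2}\nabla u)$. A solution is a weak solution: $u\in W_0^{1,p}$ with $\int_\Omega|\nabla u|^{p-2}\nabla u\nabla\varphi\,dx=\lambda\int_\Omega|u|^{p-2}u\varphi\,dx+\int_\Omega a|u|^{q-2}u\varphi\,dx$ for all $\varphi\in W_0^{1,p}$. Any solution belongs to $C^{1,\beta}_0(\overline\Omega)$ for some $\beta\in(0,1)$, so pointwise statements make sense. *)

(* Defs.v *)
From HB Require Import structures.
From mathcomp Require Import all_boot all_order all_algebra.
From mathcomp Require Import all_classical all_reals all_analysis.

Set Implicit Arguments.
Unset Strict Implicit.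
Unset Printing Implicit Defensive.

Import Order.TTheory GRing.Theory Num.Theory.
Import numFieldNormedType.Exports.

Local Open Scope classical_set_scope.
Local Open Scope ring_scope.

Definition measure_rV_display : measure_display -> measure_display.
Proof. exact. Qed.

Section measurable_rV.
Context {d} {T : measurableType d}.
Variable n : nat.

Let coors : 'I_n -> 'rV[T]_n -> T := fun i v => v ord0 i.

Let rV_set0 : g_sigma_preimage coors set0.
Proof. exact: sigma_algebra0. Qed.

Let rV_setC A : g_sigma_preimage coors A -> g_sigma_preimage coors (~` A).
Proof. exact: sigma_algebraC. Qed.

Let rV_bigcup (F : _^nat) : (forall i, g_sigma_preimage coors (F i)) ->
  g_sigma_preimage coors (\bigcup_i (F i)).
Proof. exact: sigma_algebra_bigcup. Qed.

HB.instance Definition _ := @isMeasurable.Build (measure_rV_display d)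
  'rV[T]_n (g_sigma_preimage coors) rV_set0 rV_setC rV_bigcup.

Lemma measurable_coord (i : 'I_n) :
  measurable_fun [set: 'rV[T]_n] (fun v : 'rV[T]_n => v ord0 i).
Proof.
move=> _ Y mY; rewrite setTI; apply: sub_sigma_algebra => /=.
rewrite -bigcup_seq/=; exists i => /=; first by rewrite mem_index_enum.
by exists Y => //; rewrite setTI.
Qed.

Lemma measurable_fun_coordP d1 (T1 : measurableType d1) (f : T1 -> 'rV[T]_n) :
  (forall i, measurable_fun [set: T1] (fun x => f x ord0 i)) ->
  measurable_fun [set: T1] f.
Proof.
move=> mf _ A mA; rewrite setTI; move: A mA.
suff: g_sigma_preimage coors `<=` [set A | measurable (f @^-1` A)] by [].
apply: smallest_sub.
  split => /=.
  - by rewrite preimage_set0.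
  - by move=> A mA; rewrite setTD preimage_setC; exact: measurableC.
  - by move=> F mF; rewrite preimage_bigcup; exact: bigcup_measurable.
rewrite -bigcup_seq; apply: bigcup_sub => i _ _ [B mB <-] /=.
rewrite setTI -comp_preimage -[X in measurable X]setTI.
exact: mf.
Qed.

End measurable_rV.

(* N-dimensional Lebesgue measure on the Borel sets of R^N, obtained as an
   iterated product measure; see lebesgue_rV_box for its value on boxes. *)
Section lebesgue_rV.
Context {R : realType}.

Definition rV_cons n (xv : measurableTypeR R * 'rV[R]_n) : 'rV[R]_n.+1 :=
  \row_i oapp (fun j => xv.2 ord0 j) xv.1 (unlift ord0 i).

Definition rV_uncons n (v : 'rV[R]_n.+1) : measurableTypeR R * 'rV[R]_n :=
  (v ord0 ord0, \row_j v ord0 (lift ord0 j)).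

Lemma rV_consK n : cancel (@rV_cons n) (@rV_uncons n).
Proof.
move=> [x v]; rewrite /rV_uncons /rV_cons !mxE unlift_none /=.
by congr pair; apply/rowP => j; rewrite !mxE liftK.
Qed.

Lemma rV_unconsK n : cancel (@rV_uncons n) (@rV_cons n).
Proof.
move=> v; apply/rowP => i; rewrite mxE; case: unliftP => [j|] -> //=.
by rewrite mxE.
Qed.

Lemma measurable_rV_cons n : measurable_fun [set: (measurableTypeR R * 'rV[R]_n)%type] (@rV_cons n).
Proof.
apply: measurable_fun_coordP => i.
under eq_fun do rewrite mxE.
case: (unlift ord0 i) => [j|] /=.
  exact: measurableT_comp (measurable_coord j) measurable_snd.
exact: measurable_fst.
Qed.

Lemma measurable_rV_uncons n : measurable_fun [set: 'rV[R]_n.+1] (@rV_uncons n).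
Proof.
apply: measurable_fun_pair; first exact: measurable_coord.
apply: measurable_fun_coordP => i.
under eq_fun do rewrite mxE.
exact: measurable_coord.
Qed.

Section step.
Local Open Scope ereal_scope.
Variables (n : nat) (m : {sigma_finite_measure set 'rV[R]_n -> \bar R}).

Let step := pushforward (@lebesgue_measure R \x m) (@rV_cons n).

Let step0 : step set0 = 0.
Proof. by rewrite /step /pushforward preimage_set0 measure0. Qed.

Let step_ge0 A : 0 <= step A.
Proof. by rewrite /step /pushforward measure_ge0. Qed.

Let step_sigma_additive : semi_sigma_additive step.
Proof.
move=> F mF tF mUF; rewrite /step /pushforward preimage_bigcup.
have mpre A : measurable A -> measurable (@rV_cons n @^-1` A).
  by move=> mA; rewrite -[X in measurable X]setTI; exact: measurable_rV_cons.
apply: measure_semi_sigma_additive.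
- by move=> k; exact: mpre.
- apply/trivIsetP => /= i j _ _ ij; rewrite -preimage_setI.
  by move/trivIsetP : tF => /(_ _ _ _ _ ij) ->//; rewrite preimage_set0.
- by rewrite -preimage_bigcup; exact: mpre.
Qed.

HB.instance Definition _ := isMeasure.Build _ _ _ step
  step0 step_ge0 step_sigma_additive.

Let step_sigma_finite : sigma_finite setT step.
Proof.
have /sigma_finiteP[F [TF ndF Foo]] := sigma_finiteT (@lebesgue_measure R).
have /sigma_finiteP[G [TG ndG Goo]] := sigma_finiteT m.
have mpre A : measurable A -> measurable (@rV_uncons n @^-1` A).
  by move=> mA; rewrite -[X in measurable X]setTI; exact: measurable_rV_uncons.
exists (fun k => @rV_uncons n @^-1` (F k `*` G k)).
  rewrite -preimage_bigcup (_ : \bigcup_k _ = setT) ?preimage_setT//.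
  rewrite -setXTT TF TG predeqE => -[x y]; split.
    by move=> [k _ []/= ? ?]; split; exists k.
  move=> [/= [i _ Fix] [k _ Gky]]; exists (maxn i k) => //; split.
  - by move: x Fix; exact/subsetPset/ndF/leq_maxl.
  - by move: y Gky; exact/subsetPset/ndG/leq_maxr.
move=> k; have [? ?] := Foo k; have [? ?] := Goo k; split.
  by apply: mpre; exact: measurableX.
rewrite /step /pushforward -comp_preimage.
rewrite (_ : _ \o _ = id); last by apply/funext => x /=; rewrite rV_consK.
by rewrite preimage_id product_measure1E// lte_mul_pinfty// ge0_fin_numE.
Qed.

HB.instance Definition _ := @Measure_isSigmaFinite.Build _ _ _ step
  step_sigma_finite.

Definition lebesgue_rV_step : {sigma_finite_measure set 'rV[R]_n.+1 -> \bar R} :=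
  step.

End step.

Fixpoint lebesgue_rV n : {sigma_finite_measure set 'rV[R]_n -> \bar R} :=
  match n with
  | 0 => dirac (0 : 'rV[R]_0)
  | n.+1 => lebesgue_rV_step (lebesgue_rV n)
  end.

Lemma measurable_rV_box n (A : 'I_n -> set R) : (forall i, measurable (A i)) ->
  measurable [set v : 'rV[R]_n | forall i, A i (v ord0 i)].
Proof.
move=> mA.
rewrite (_ : mkset _ =
    \big[setI/setT]_(i < n) (fun v : 'rV[R]_n => v ord0 i) @^-1` A i).
  apply: bigsetI_measurable => i _; rewrite -[X in measurable X]setTI.
  exact: measurable_coord.
rewrite -bigcap_seq; apply/seteqP; split => v /= Av.
  by move=> i _; exact: Av.
by move=> i; apply: Av; rewrite /= mem_index_enum.
Qed.

Lemma lebesgue_rV_box n (A : 'I_n -> set R) : (forall i, measurable (A i)) ->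
  (lebesgue_rV n [set v | forall i, A i (v ord0 i)] =
   \prod_(i < n) lebesgue_measure (A i))%E.
Proof.
elim: n A => [|n IH] A mA.
  by rewrite big_ord0 /= diracE mem_set//=; case.
rewrite big_ord_recl -IH; last by [].
have mB := @measurable_rV_box n (fun i => A (lift ord0 i)) (fun i => mA _).
set B := (X in measurable X) in mB.
transitivity ((@lebesgue_measure R \x lebesgue_rV n)%E (A ord0 `*` B)).
  2: by apply: product_measure1E => //; exact: mA.
rewrite /= /pushforward; congr (_ _); apply/seteqP; split => [[x v] /= Av|[x v] /= [Ax Av] i].
  split; first by have := Av ord0; rewrite mxE unlift_none.
  by move=> i; have := Av (lift ord0 i); rewrite mxE liftK.
by rewrite mxE; case: unliftP => [j|] -> /=.
Qed.

End lebesgue_rV.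

Section sobolev.
Context {R : realType} {N : nat}.
Implicit Types (Omega : set 'rV[R]_N) (G : 'rV[R]_N -> 'rV[R]_N).

(* The library norm on 'rV[R]_N is the sup norm, hence the explicit
   Euclidean norm. *)
Definition dotv (v w : 'rV[R]_N) : R := \sum_i v ord0 i * w ord0 i.

Definition enorm (v : 'rV[R]_N) : R := Num.sqrt (dotv v v).

Definition partial n (i : 'I_n) (f : 'rV[R]_n -> R) : 'rV[R]_n -> R :=
  'D_(delta_mx ord0 i) f.

Definition grad (f : 'rV[R]_N -> R) (x : 'rV[R]_N) : 'rV[R]_N :=
  \row_i partial i f x.

Fixpoint of_class_C n (k : nat) (f : 'rV[R]_n -> R) : Prop :=
  match k with
  | 0 => continuous f
  | k.+1 => (forall x, differentiable f x) /\
            forall i, of_class_C k (partial i f)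
  end.

(* Near each boundary point, Omega is one side of the graph of a C^2 function
   of the N - 1 coordinates other than the i-th one. *)
Definition C2_boundary Omega : Prop :=
  forall x0, (closure Omega `\` Omega) x0 ->
  exists (i : 'I_N) (s : bool) (gamma : 'rV[R]_N.-1 -> R),
    of_class_C 2 gamma /\
    \forall x \near x0,
      Omega x <-> 0 < (-1) ^+ s * (x ord0 i - gamma (col' i x)).

Definition test_function Omega (phi : 'rV[R]_N -> R) : Prop :=
  [/\ forall k, of_class_C k phi,
      compact (closure [set x | phi x != 0]) &
      closure [set x | phi x != 0] `<=` Omega].

Local Notation mu := (lebesgue_rV N).

(* f \_ Omega is the extension of the restriction of f to Omega by 0. *)
Definition in_Lp Omega (r : R) (f : 'rV[R]_N -> R) : Prop :=
  f \_ Omega \in Lfun mu r%:E.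

Definition Lp_norm Omega (r : R) (f : 'rV[R]_N -> R) : \bar R :=
  ('N[mu]_r%:E [EFin \o (f \_ Omega)])%E.

Definition weak_gradient Omega (u : 'rV[R]_N -> R) G : Prop :=
  forall phi, test_function Omega phi -> forall i : 'I_N,
    \int[mu]_(x in Omega) (u x * partial i phi x) =
    - \int[mu]_(x in Omega) (G x ord0 i * phi x).

(* Elements of W^{1,p} are handled together with their weak gradient G,
   which is determined by u almost everywhere. *)
Definition W1p Omega (p : R) (u : 'rV[R]_N -> R) G : Prop :=
  [/\ in_Lp Omega p u,
      forall i : 'I_N, in_Lp Omega p (fun x => G x ord0 i) &
      weak_gradient Omega u G].

Definition W01p Omega (p : R) (u : 'rV[R]_N -> R) G : Prop :=
  W1p Omega p u G /\
  exists phi : nat -> 'rV[R]_N -> R,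
    [/\ forall k, test_function Omega (phi k),
        Lp_norm Omega p (fun x => u x - phi k x) @[k --> \oo] --> 0%E &
        Lp_norm Omega p (fun x => enorm (G x - grad (phi k) x))
          @[k --> \oo] --> 0%E].

Definition first_eigenvalue Omega (p : R) : R :=
  inf [set r | exists u G,
    [/\ W01p Omega p u G,
        ~ {ae mu, forall x, Omega x -> u x = 0} &
        r = fine (Lp_norm Omega p (enorm \o G)) `^ p
            / fine (Lp_norm Omega p u) `^ p]].

Definition plaplace_form Omega (p : R) G H : R :=
  \int[mu]_(x in Omega) (enorm (G x) `^ (p - 2) * dotv (G x) (H x)).

(* phi_p: positivity is that of the continuous representative. *)
Definition first_eigenfunction Omega (p : R) (phi : 'rV[R]_N -> R) : Prop :=
  exists G,
    [/\ W01p Omega p phi G,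
        forall v H, W01p Omega p v H ->
          plaplace_form Omega p G H =
          first_eigenvalue Omega p *
            \int[mu]_(x in Omega) (`|phi x| `^ (p - 2) * phi x * v x),
        forall x, Omega x -> {for x, continuous phi},
        forall x, Omega x -> 0 < phi x &
        Lp_norm Omega p (enorm \o G) = 1%E].

Definition weak_solution Omega (p q : R) (a : 'rV[R]_N -> R) (lambda : R)
    (u : 'rV[R]_N -> R) : Prop :=
  exists G, W01p Omega p u G /\
    forall v H, W01p Omega p v H ->
      plaplace_form Omega p G H =
      lambda * \int[mu]_(x in Omega) (`|u x| `^ (p - 2) * u x * v x)
      + \int[mu]_(x in Omega) (a x * `|u x| `^ (q - 2) * u x * v x).

(* A solution is an a.e. class of functions; pointwise statements refer to
   its continuous representative. *)
Definition solution Omega (p q : R) (a : 'rV[R]_N -> R) (lambda : R)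
    (u : 'rV[R]_N -> R) : Prop :=
  weak_solution Omega p q a lambda u /\
  forall x, Omega x -> {for x, continuous u}.

Definition pos_part_dom Omega (a : 'rV[R]_N -> R) : set 'rV[R]_N :=
  [set x | Omega x /\ 0 < a x].

Definition neg_part_dom Omega (a : 'rV[R]_N -> R) : set 'rV[R]_N :=
  [set x | Omega x /\ a x < 0].

End sobolev.

(* Main.v *)
Require Import Defs.
From HB Require Import structures.
From mathcomp Require Import all_boot all_order all_algebra.
From mathcomp Require Import all_classical all_reals all_analysis.
From mathcomp Require Import measurable_realfun ring lra.

(** The theorem follows from a Picone inequality with mixed exponents: for
    positive [m] and [v],
      |Dv|^(p-2) Dv . D(m^q v^(1-q)) <= |Dm|^(p-2) Dm . D(m^(q-p+1) v^(p-q)).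
    With s = (m/v) |Dv| / |Dm| and c the cosine of the angle between the two
    gradients, the difference of the sides is a positive multiple of
      (q-p+1) + (p-q) s c - q s^(p-1) c + (q-1) s^p,
    which is affine in c. At c = -1 it is nonnegative by the assumption on p
    and q; at c = 1 by the weighted inequality between arithmetic and geometric
    means ([picone_scalar]).

    Formally, m = phi and v = u: testing the equation of [u] with
    phi^q u^(1-q), and that of [phi] with phi^(q-p+1) u^(p-q), gives
      (lambda - lambda_1) int u^(p-q) phi^q + int_{u > 0} a phi^q <= 0.
    Since [u] is positive where [a] is, a <= 0 on {u = 0}, so the second
    integral is at least int a phi^q. This is absurd if int a phi^q > 0 and
    lambda >= lambda_1. It is also absurd if int a phi^q = 0 and
    lambda > lambda_1, because int u^(p-q) phi^q > 0: [u] is continuous,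
    nonnegative and not identically zero.

    These test functions are not admissible as they stand: [u] may vanish in
    Omega, and no bounds on [u] and [phi] are at hand. Both functions are
    therefore composed with a smooth function [trunc M] of the real line which
    is bounded, bounded away from 0, concave on [0, +oo), has slope in [0, 1]
    there, and tends to the identity with its slope as M grows. The constant
    [trunc M 0] is subtracted, so that the test functions vanish where [phi]
    and [u] do. As [trunc M] is smooth on the whole line, composing it with
    test functions that approximate [phi] and [u] yields test functions again;
    the equations for the composed functions follow by dominated convergence
    ([limit_test_equation]), and a chain rule in Sobolev spaces is replaced by
    the one for smooth functions. What remains is that a test function together
    with its classical gradient belongs to the Sobolev space
    ([test_function_W01p]), that is, integration by parts, which is Fubini's
    theorem and the fundamental theorem of calculus
    ([integral_partial_compact]).

    Where the slopes of [trunc M] at [phi] and at [u] differ, the pointwise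
    inequality has an error term ([picone_pointwise]). By concavity the larger
    slope belongs to the smaller of m and v, so this error is controlled by
    |Dphi|^p (1 - slope) and |Du|^(p-1) |Dphi| (1 - slope), which tend to 0 in
    L^1 ([cvg_picone_err]). Concavity also gives the bound m / v <= phi / u for
    u <= phi, from which the integrands on the right of the tested equations
    are dominated by a multiple of (u + phi + 4)^p ([trunc_quotient_le]). *)

Set Implicit Arguments.
Unset Strict Implicit.
Unset Printing Implicit Defensive.

Import Order.TTheory GRing.Theory Num.Theory.
Import numFieldNormedType.Exports.

Local Open Scope classical_set_scope.
Local Open Scope ring_scope.

(** * Lebesgue measure and the topology of R^N *)

(** An open set is the union of the boxes with rational endpoints that it
    contains, and there are countably many of these. *)
Lemma open_rV_measurable (R : realType) n (U : set 'rV[R]_n) :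
  open U -> measurable U.
Proof.
move=> oU.
pose B (cd : 'rV[rat]_n * 'rV[rat]_n) := [set v : 'rV[R]_n |
  forall i, `]ratr (cd.1 ord0 i), ratr (cd.2 ord0 i)[%classic (v ord0 i)].
pose F cd := if `[< B cd `<=` U >] then B cd else set0.
suff -> : U = \bigcup_cd F cd.
  apply: countable_bigcupT_measurable.
    exact: countableP.
  move=> cd; rewrite /F; case: ifPn => // _.
  exact: (@measurable_rV_box R n
    (fun i => `]ratr (cd.1 ord0 i), ratr (cd.2 ord0 i)[%classic)).
apply/seteqP; split => [x Ux|x [cd _]]; last first.
  by rewrite /F; case: asboolP => // BU Bx; exact: BU.
have /nbhs_ballP[e /= e0 xeU] := open_nbhs_nbhs (conj oU Ux).
have lo (i : 'I_n) : {r : rat | ratr r \in `]x ord0 i - e, x ord0 i[}.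
  by apply/cid/rat_in_itvoo; rewrite ltrBlDr ltrDl.
have hi (i : 'I_n) : {r : rat | ratr r \in `]x ord0 i, x ord0 i + e[}.
  by apply/cid/rat_in_itvoo; rewrite ltrDl.
exists (\row_i sval (lo i), \row_i sval (hi i)) => //.
have Bx : B (\row_i sval (lo i), \row_i sval (hi i)) x.
  move=> i /=; rewrite !mxE in_itv/=.
  case: (lo i) (hi i) => /= a + [/= b].
  by rewrite !in_itv/= => /andP[_ ->] /andP[-> _].
rewrite /F; case: asboolP => // -[] y By; apply: xeU.
split=> // i0 i; rewrite (ord1 i0) /ball/=; have := By i; rewrite /= !mxE in_itv/=.
case: (lo i) (hi i) => /= a + [/= b].
rewrite !in_itv/= => /andP[a1 a2] /andP[b1 b2] /andP[y1 y2].
by rewrite ltr_norml; apply/andP; split; lra.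
Qed.

Lemma continuous_in_measurable (R : realType) n (D : set 'rV[R]_n)
    (f : 'rV[R]_n -> R) : open D -> {in D, continuous f} ->
  measurable_fun D f.
Proof.
move=> oD cf mD; apply: (measurability _ (RGenOpens.measurableE R)) => //.
move=> _ [_ [a [b ->]] <-]; apply: open_rV_measurable.
rewrite openE => x [Dx fx]; apply: filterI.
  exact: (open_nbhs_nbhs (conj oD Dx)).
apply: cf; first exact: mem_set.
exact: (open_nbhs_nbhs (conj (itv_open _ _) fx)).
Qed.

Lemma continuous_rV_measurable (R : realType) n (f : 'rV[R]_n -> R) :
  continuous f -> measurable_fun setT f.
Proof.
by move=> cf; apply: continuous_in_measurable; [exact: openT | move=> x _].
Qed.

Lemma continuous_rV_measurable_on (R : realType) n (D : set 'rV[R]_n) (f : 'rV[R]_n -> R) :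
  continuous f -> measurable_fun D f.
Proof. by move=> cf; apply: measurable_funTS; exact: continuous_rV_measurable. Qed.

(** A bounded set lies in a cube. *)
Lemma lebesgue_rV_bounded_lty (R : realType) n (A : set 'rV[R]_n) :
  bounded_set A -> measurable A -> (lebesgue_rV n A < +oo)%E.
Proof.
move=> [M0 [_ bA]] mA; pose M := M0 + 1.
have AM v : A v -> `|v| <= M by apply: bA; rewrite ltrDl.
pose I (i : 'I_n) := `[- M, M]%classic.
apply: (@le_lt_trans _ _ (lebesgue_rV n [set v | forall i, I i (v ord0 i)])).
  apply: le_measure; rewrite ?inE//.
    by apply: (@measurable_rV_box _ _ I) => i; exact: measurable_itv.
  move=> v Av i; rewrite /I/= in_itv/= -ler_norml.
  apply: le_trans (AM v Av); rewrite /Num.norm/= mx_normrE.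
  exact: (le_bigmax _ (fun ij : 'I_1 * 'I_n => `|v ij.1 ij.2|) (ord0, i)).
rewrite lebesgue_rV_box; last by move=> i; exact: measurable_itv.
under eq_bigr do rewrite /I lebesgue_measure_itv.
rewrite -ge0_fin_numE; last by apply: prode_ge0 => i _; case: ifP => // /=;
  rewrite lte_fin => MM; rewrite -EFinB lee_fin; lra.
apply: prode_fin_num => i _; case: ifP => //=.
Qed.

(** A ball of the sup norm is a box. *)
Lemma lebesgue_rV_open_gt0 (R : realType) n (A : set 'rV[R]_n) :
  open A -> A !=set0 -> (0 < lebesgue_rV n A)%E.
Proof.
move=> oA [x Ax].
have /nbhs_ballP[e /= e0 xeA] := open_nbhs_nbhs (conj oA Ax).
pose I (i : 'I_n) := ball (x ord0 i) e.
have mI i : measurable (I i) by exact: measurable_ball.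
apply: (@lt_le_trans _ _ (lebesgue_rV n [set v | forall i, I i (v ord0 i)])); last first.
  apply: le_measure; rewrite ?inE//.
  - exact: (@measurable_rV_box _ _ I).
  - exact: open_rV_measurable.
  by move=> v Iv; apply: xeA; split => // i0 i; rewrite (ord1 i0); exact: Iv.
rewrite lebesgue_rV_box//; under eq_bigr do rewrite /I lebesgue_measure_ball ?(ltW e0)//.
rewrite prodEFin lte_fin; apply: prodr_gt0 => i _; by rewrite pmulrn_rgt0.
Qed.

(** * Functions of class C^k *)

Section smooth.
Context {R : realType} {n : nat}.
Implicit Types (f g : 'rV[R]_n -> R) (i : 'I_n).

Lemma of_class_C_continuous k f : of_class_C k f -> continuous f.
Proof.
case: k => [//|k] [df _] x; exact: differentiable_continuous.
Qed.

Lemma of_class_CW k f : of_class_C k.+1 f -> of_class_C k f.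
Proof.
elim: k f => [|k IH] f; first exact: of_class_C_continuous.
by move=> [df pf]; split => // i; apply: IH; exact: pf.
Qed.

Lemma of_class_C_cst k (c : R) : of_class_C k (fun _ : 'rV[R]_n => c).
Proof.
elim: k c => [|k IH] c /=; first exact: cst_continuous.
split=> [x|i]; first exact: differentiable_cst.
rewrite (_ : partial i _ = fun=> 0); first exact: IH.
by apply/funext => x; rewrite /partial derive_cst.
Qed.

Lemma partialD i f g x : differentiable f x -> differentiable g x ->
  partial i (fun y => f y + g y) x = partial i f x + partial i g x.
Proof. by move=> df dg; rewrite /partial deriveD//; exact: diff_derivable. Qed.

Lemma partialM i f g x : differentiable f x -> differentiable g x ->
  partial i (fun y => f y * g y) x = partial i f x * g x + f x * partial i g x.
Proof.
move=> df dg; rewrite /partial deriveM//; [|exact: diff_derivable..].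
by rewrite addrC /GRing.scale/= (mulrC (g x)).
Qed.

Lemma partial_comp i f (h : R -> R) (dh : R) x : differentiable f x ->
  is_derive (f x) 1 h dh -> partial i (h \o f) x = dh * partial i f x.
Proof.
move=> df [/derivable1_diffP dh' hE].
rewrite /partial deriveE; last exact: differentiable_comp.
rewrite diff_comp//= deriv1E/=; last exact/derivable1_diffP.
by rewrite -deriveE// derive1E hE /GRing.scale/= mulrC.
Qed.

Lemma differentiable_comp_R f (h : R -> R) (dh : R) x : differentiable f x ->
  is_derive (f x) 1 h dh -> differentiable (h \o f) x.
Proof.
by move=> df [/derivable1_diffP dh' hE]; exact: differentiable_comp.
Qed.

Lemma of_class_CD k f g : of_class_C k f -> of_class_C k g ->
  of_class_C k (fun x => f x + g x).
Proof.
elim: k f g => [|k IH] f g; first by move=> cf cg x; exact: (cvgD (cf x) (cg x)).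
move=> [df pf] [dg pg]; split=> [x|i]; first exact: differentiableD.
rewrite (_ : partial i _ = fun x => partial i f x + partial i g x).
  exact: IH (pf i) (pg i).
by apply/funext => x; exact: partialD.
Qed.

Lemma of_class_CM k f g : of_class_C k f -> of_class_C k g ->
  of_class_C k (fun x => f x * g x).
Proof.
elim: k f g => [|k IH] f g; first by move=> cf cg x; exact: (cvgM (cf x) (cg x)).
move=> cf cg; have [df pf] := cf; have [dg pg] := cg.
split=> [x|i]; first exact: differentiableM.
rewrite (_ : partial i _ = fun x => partial i f x * g x + f x * partial i g x).
  by apply: of_class_CD; apply: IH; do [exact: pf|exact: pg|exact: of_class_CW].
by apply/funext => x; exact: partialM.
Qed.

Lemma of_class_C_expR k f : of_class_C k f -> of_class_C k (expR \o f).
Proof.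
elim: k f => [|k IH] f.
  by move=> cf x; apply: continuous_comp; [exact: cf|exact: continuous_expR].
move=> cf; have [df pf] := cf; split=> [x|i].
  exact: (differentiable_comp_R (df x) (is_derive_expR _)).
rewrite (_ : partial i _ = fun x => expR (f x) * partial i f x).
  by apply: of_class_CM; [apply: IH; exact: of_class_CW|exact: pf].
by apply/funext => x; exact: (partial_comp _ (df x) (is_derive_expR _)).
Qed.

(** The induction on [k] must range over all exponents, since differentiating
    lowers [r] by one. *)
Lemma of_class_C_powR k f (r : R) : (forall x, 0 < f x) -> of_class_C k f ->
  of_class_C k ((fun y => y `^ r) \o f).
Proof.
move=> f0; elim: k r => [|k IH] r.
  move=> cf x; apply: continuous_comp; first exact: cf.
  by have [/derivable1_diffP/differentiable_continuous] := is_derive1_powR r (f0 x).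
move=> cf; have [df pf] := cf; split=> [x|i].
  exact: (differentiable_comp_R (df x) (is_derive1_powR r (f0 x))).
rewrite (_ : partial i _ = fun x => (r * f x `^ (r - 1)) * partial i f x).
  apply: of_class_CM; last exact: pf.
  apply: of_class_CM; first exact: of_class_C_cst.
  by apply: IH; exact: of_class_CW.
by apply/funext => x; exact: (partial_comp _ (df x) (is_derive1_powR r (f0 x))).
Qed.

End smooth.

(** * Integration by parts on R^N *)

Section ibp.
Context {R : realType}.

Lemma rV_cons_continuousl n (v : 'rV[R]_n) :
  continuous (fun x : R => rV_cons (x, v)).
Proof.
move=> x; apply/cvg_ballP => e e0; near=> y; split => // i0 i.
rewrite !mxE; case: unliftP => [j|] _ /=; first exact: ballxx.
near: y; exact: (nbhsx_ballx x e e0).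
Unshelve. all: by end_near. Qed.

Lemma rV_cons_continuousr n (x : R) :
  continuous (fun v : 'rV[R]_n => rV_cons (x, v)).
Proof.
move=> v; apply/(@cvg_ballP _ _ _ _ (nbhs_filter v)) => e e0.
near=> w; split => // i0 i.
rewrite !mxE; case: unliftP => [j|] _ /=; last exact: ballxx.
have vw : ball v e w by near: w; apply: nbhsx_ballx.
by case: vw.
Unshelve. all: by end_near. Qed.

(** Directional derivatives only see the values along a line. This identifies
    the partial derivatives of a function on R^(n+1) with those of its slices
    without discussing differentiability of the slices. *)
Lemma derive_reparam (V W : normedModType R) (f : V -> R) (g : W -> R)
    (a v : V) (b w : W) :
  (forall h : R, f (h *: v + a) = g (h *: w + b)) ->
  'D_v f a = 'D_w g b /\ (derivable f a v = derivable g b w).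
Proof.
move=> fg; have fgab : f a = g b by have := fg 0; rewrite !scale0r !add0r.
rewrite /derive /derivable.
have -> : (fun h : R => h^-1 *: ((f \o shift a) (h *: v) - f a)) =
          (fun h : R => h^-1 *: ((g \o shift b) (h *: w) - g b)).
  by apply/funext => h /=; rewrite fg fgab.
by [].
Qed.

Lemma rV_cons_shiftl n (h x : R) (v : 'rV[R]_n) :
  rV_cons (h *: 1 + x, v) = h *: delta_mx ord0 ord0 + rV_cons (x, v).
Proof.
apply/rowP => i; rewrite !mxE.
case: unliftP => [j|] -> //=; by rewrite mulr0 add0r.
Qed.

Lemma rV_cons_shiftr n (h x : R) (v : 'rV[R]_n) (j : 'I_n) :
  rV_cons (x, h *: delta_mx ord0 j + v) =
  h *: delta_mx ord0 (lift ord0 j) + rV_cons (x, v).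
Proof.
apply/rowP => i; rewrite !mxE.
case: unliftP => [k|] -> /=; first by rewrite !mxE (inj_eq lift_inj).
by rewrite mulr0 add0r.
Qed.

Lemma near_eq0_partial n (f : 'rV[R]_n -> R) (i : 'I_n) (x : 'rV[R]_n) :
  (\forall y \near x, f y = 0) -> partial i f x = 0.
Proof.
move=> f0; rewrite /partial -(derive_cst (0:R) x (delta_mx ord0 i)).
exact: near_eq_derive.
Qed.

Lemma partial_outside_cube n (f : 'rV[R]_n -> R) (K : R) (i j : 'I_n) (x : 'rV[R]_n) :
  (forall (y : 'rV[R]_n) (k : 'I_n), K < `|y ord0 k| -> f y = 0) -> K < `|x ord0 j| ->
  partial i f x = 0.
Proof.
move=> fK Kx; apply: near_eq0_partial.
have : \forall y \near x, K < `|(y : 'rV[R]_n) ord0 j|.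
  have /cvgr_gt : (fun y : 'rV[R]_n => `|y ord0 j|) y @[y --> x] --> `|x ord0 j|.
    exact: (cvg_norm (@coord_continuous R 1 n ord0 j x)).
  exact.
by apply: filterS => y; exact: fK.
Qed.

Lemma measurable_cube n (K : R) :
  measurable [set v : 'rV[R]_n | forall j, `|v ord0 j| <= K].
Proof.
have := @measurable_rV_box R n (fun=> `[- K, K]%classic) (fun=> measurable_itv _).
by congr measurable; apply/seteqP; split => v /= + j => /(_ j);
  rewrite in_itv/= -ler_norml.
Qed.

Lemma lebesgue_rV_cube_lty n (K : R) :
  (lebesgue_rV n [set v : 'rV[R]_n | forall j, (`|v ord0 j| <= K)%R] < +oo)%E.
Proof.
apply: lebesgue_rV_bounded_lty; last exact: measurable_cube.
exists (Num.max K 0); split; first exact: num_real.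
move=> x Kx v Kv /=; rewrite /Num.norm/= mx_normrE; apply: bigmax_le.
  by rewrite (le_trans _ (ltW Kx))// le_max lexx orbT.
move=> [i0 i] _ /=; rewrite (ord1 i0) (le_trans (Kv i))// (le_trans _ (ltW Kx))//.
by rewrite le_max lexx.
Qed.

Lemma integrable_bounded_support d (T : measurableType d) (mu : {measure set T -> \bar R})
  (D : set T) (B : R) (g : T -> R) : measurable D -> (mu D < +oo)%E ->
  measurable_fun setT g -> (forall x, `|g x| <= B) -> (forall x, ~ D x -> g x = 0) ->
  mu.-integrable setT (EFin \o g).
Proof.
move=> mD Doo mg gB g0.
have -> : EFin \o g = (EFin \o g) \_ D.
  apply/funext => x; rewrite patchE; case: ifPn => // /negP; rewrite inE => Dx.
  by rewrite /= g0.
apply/(integrable_mkcond _ mD); apply: measurable_bounded_integrable => //.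
  exact: measurable_funTS.
exists B; split; first exact: num_real.
by move=> x Bx y _ /=; rewrite (le_trans (gB y))// ltW.
Qed.

Lemma integral_derive_compact (F : R -> R) (K : R) :
  (forall x, derivable F x 1) -> continuous (fun x => 'D_1 F x) ->
  (forall x, K < `|x| -> F x = 0) ->
  (\int[lebesgue_measure]_x ('D_1 F x)%:E = 0)%E.
Proof.
move=> dF cF FK; pose L := Num.max K 0 + 1.
have L0 : 0 < L by rewrite ltr_wpDl// le_max lexx orbT.
have KL : K < L by rewrite (@le_lt_trans _ _ (Num.max K 0)) ?ltrDl// le_max lexx.
(* K may be negative; L is positive, and F vanishes at both ends of [-L, L]. *)
have F'0 x : ~ `[-L, L]%classic x -> 'D_1 F x = 0.
  rewrite /= in_itv/= -ler_norml => /negP; rewrite -ltNge => Lx.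
  rewrite -(derive_cst (0:R) x (1:R)); apply: near_eq_derive.
  have /cvgr_gt : (fun y : R => `|y|) y @[y --> x] --> `|x| by apply: cvg_norm.
  by move=> /(_ _ Lx); apply: filterS => y Ly; rewrite FK// (lt_trans KL).
rewrite (_ : (fun x => ('D_1 F x)%:E) = (fun x => ('D_1 F x)%:E) \_ `[-L, L]); last first.
  apply/funext => x; rewrite patchE; case: ifPn => // /negP; rewrite inE => Dx.
  by rewrite F'0.
have contF : continuous F.
  by move=> x; apply: differentiable_continuous; exact/derivable1_diffP.
rewrite -integral_mkcond (@continuous_FTC2 _ _ F).
- by rewrite !FK ?subee// ?normrN gtr0_norm.
- by rewrite (lt_trans _ L0)// oppr_lt0.
- by apply: continuous_subspaceT.
- split; first by move=> x _; exact: dF.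
    by apply: cvg_at_right_filter; exact: contF.
  by apply: cvg_at_left_filter; exact: contF.
- by move=> x _; rewrite derive1E.
Qed.

(** By Fubini, integrate first in a way that makes the inner integral vanish:
    along the first coordinate for the first partial derivative, by the
    fundamental theorem of calculus, and over the other coordinates for the
    remaining ones, by induction. The hypotheses are stated with directional
    derivatives because these pass to slices. *)
Lemma integral_partial_compact n (f : 'rV[R]_n -> R) (K B : R) :
  (forall i x, derivable f x (delta_mx ord0 i)) ->
  (forall i, continuous (partial i f)) ->
  (forall (y : 'rV[R]_n) (k : 'I_n), K < `|y ord0 k| -> f y = 0) ->
  (forall i x, `|partial i f x| <= B) ->
  forall i, (\int[lebesgue_rV n]_x (partial i f x)%:E = 0)%E.
Proof.
elim: n f => [|n IH] f df cf fK fB i; first by case: i.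
pose g := partial i f.
have mg : measurable_fun setT g by exact: continuous_rV_measurable (cf i).
have cons_m := @measurable_rV_cons R n.
pose P := (@lebesgue_measure R \x lebesgue_rV n)%E.
have ig : P.-integrable setT ((EFin \o g) \o @rV_cons R n).
  have mb := @measurable_cube n.+1 K.
  apply: (@integrable_bounded_support _ _ _ (@rV_cons R n @^-1`
    [set v : 'rV[R]_n.+1 | forall j, `|v ord0 j| <= K]) B (g \o @rV_cons R n)).
  - by rewrite -[X in measurable X]setTI; exact: cons_m.
  - exact: (@lebesgue_rV_cube_lty n.+1 K).
  - exact: measurableT_comp.
  - by move=> x; exact: fB.
  - move=> x /= /existsNP[j] /negP; rewrite -ltNge; exact: (partial_outside_cube i fK).
rewrite (@eq_measure_integral _ _ _ _ (pushforward P (@rV_cons R n)))//.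
have mEg : measurable_fun setT (EFin \o g) by exact/measurable_EFinP.
rewrite (integral_pushforward cons_m mEg ig measurableT).
rewrite preimage_setT; case: (unliftP ord0 i) => [j|] iE; rewrite /g iE in ig *.
- rewrite -integral12_prod_meas1//; apply: integral0_eq => x _.
  rewrite /fubini_F /=.
  have E v k : partial (lift ord0 k) f (rV_cons (x, v)) =
             partial k (fun w => f (rV_cons (x, w))) v /\ _ :=
    derive_reparam (fun h => congr1 f (esym (rV_cons_shiftr h x v k))).
  under eq_integral do rewrite (E _ _).1.
  apply: IH => [k v|k|y k Ky|k v].
  + by rewrite -(E v k).2; exact: df.
  + rewrite (_ : partial k _ = partial (lift ord0 k) f \o (fun w => rV_cons (x, w))).
      by move=> v; apply: continuous_comp; [exact: rV_cons_continuousr|exact: cf].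
    by apply/funext => w /=; rewrite (E w k).1.
  + by apply: (fK _ (lift ord0 k)); rewrite mxE liftK.
  + by rewrite -(E v k).1.
- rewrite -integral21_prod_meas1//; apply: integral0_eq => v _.
  rewrite /fubini_G /=.
  have E x : partial ord0 f (rV_cons (x, v)) = 'D_1 (fun y => f (rV_cons (y, v))) x
      /\ _ := derive_reparam (fun h => congr1 f (esym (rV_cons_shiftl h x v))).
  under eq_integral do rewrite (E _).1.
  apply: (@integral_derive_compact _ K).
  + by move=> x; rewrite -(E x).2; exact: df.
  + rewrite (_ : (fun x => _) = partial ord0 f \o (fun w => rV_cons (w, v))).
      by move=> x; apply: continuous_comp; [exact: rV_cons_continuousl|exact: cf].
    by apply/funext => w /=; rewrite (E w).1.
  + by move=> x Kx; apply: (fK _ ord0); rewrite mxE unlift_none.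
Qed.

End ibp.

(** * Dominated convergence *)

Section measure_lemmas.
Context d (T : measurableType d) (R : realType) (mu : {measure set T -> \bar R}).
Variables (D : set T) (mD : measurable D).
Implicit Types f g : T -> R.

Lemma Rintegral_dominated (f_ : nat -> T -> R) f g :
  (forall n, measurable_fun D (f_ n)) -> measurable_fun D f ->
  {ae mu, forall x, D x -> f_ n x @[n --> \oo] --> f x} ->
  mu.-integrable D (EFin \o g) ->
  {ae mu, forall x, D x -> forall n, `|f_ n x| <= g x} ->
  mu.-integrable D (EFin \o f) /\
  \int[mu]_(x in D) f_ n x @[n --> \oo] --> \int[mu]_(x in D) f x.
Proof.
move=> mf_ mf f_f ig fg.
have f_f' : {ae mu, forall x, D x -> (EFin \o f_ n) x @[n --> \oo] --> (EFin \o f) x}.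
  apply: filterS f_f => x h Dx; apply: cvg_EFin; first exact: nearW.
  exact: h.
have fg' : {ae mu, forall x n, D x -> (`|(EFin \o f_ n) x| <= (EFin \o g) x)%E}.
  by apply: filterS fg => x h n Dx; rewrite /= lee_fin; exact: h.
have [iff _ cf] := @dominated_convergence _ _ _ mu D mD (fun n => EFin \o f_ n)
  (EFin \o f) (EFin \o g)
  (fun n => (measurable_EFinP _ _).2 (mf_ n)) ((measurable_EFinP _ _).2 mf)
  f_f' ig fg'.
split=> //; apply: fine_cvg; rewrite fineK; last exact: integrable_fin_num.
exact: cf.
Qed.

Lemma integrable_dominated f g : measurable_fun D f ->
  mu.-integrable D (EFin \o g) -> (forall x, D x -> `|f x| <= g x) ->
  mu.-integrable D (EFin \o f).
Proof.
move=> mf ig fg; apply: le_integrable ig => //; first exact/measurable_EFinP.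
by move=> x Dx /=; rewrite lee_fin (le_trans (fg _ Dx))// ler_norm.
Qed.

(** Functions whose integrals decrease geometrically are dominated by their sum,
    which is integrable, hence finite almost everywhere, so that they also tend
    to 0 almost everywhere. It provides both hypotheses of dominated
    convergence at once, as one does by extracting a fast subsequence. *)
Lemma dominating_sum (e_ : nat -> T -> R) :
  (forall n, measurable_fun D (e_ n)) -> (forall n x, 0 <= e_ n x) ->
  (forall n, \int[mu]_(x in D) (e_ n x)%:E <= (2^-1 ^+ n.+1)%:E)%E ->
  exists H : T -> R, mu.-integrable D (EFin \o H) /\
    {ae mu, forall x, D x -> (forall n, e_ n x <= H x) /\ e_ n x @[n --> \oo] --> 0}.
Proof.
move=> me e0 eint.
pose S x := (\sum_(0 <= n <oo) (e_ n x)%:E)%E.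
have S0 x : (0 <= S x)%E by apply: nneseries_ge0 => n _ _; rewrite lee_fin.
have mS : measurable_fun D S.
  apply: ge0_emeasurable_sum => //; first by move=> n x _ _; rewrite lee_fin.
  by move=> n _; exact/measurable_EFinP.
have iS : mu.-integrable D S.
  apply/integrableP; split=> //.
  under eq_integral do rewrite gee0_abs//.
  rewrite integral_nneseries//; last 2 first.
  - by move=> n; exact/measurable_EFinP.
  - by move=> n x _; rewrite lee_fin.
  apply: (@le_lt_trans _ _ (1%:E)%E); last by rewrite ltry.
  apply: le_trans (@epsilon_trick0 R 1 xpredT ler01).
  apply: lee_nneseries => n _; first by move=> _; apply: integral_ge0 => x _; rewrite lee_fin.
  by rewrite (le_trans (eint n))// lee_fin div1r exprVn natrX.
have e0' k y : (0 <= (e_ k y)%:E)%E by rewrite lee_fin.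
have Sfin := integrable_ae mD iS.
exists (fine \o S); split.
  apply/integrableP; split.
    by apply/measurable_EFinP; apply: measurableT_comp.
  have /integrableP[_] := iS; apply: le_lt_trans; apply: ae_ge0_le_integral => //.
  - by apply: measurableT_comp => //; apply/measurable_EFinP; apply: measurableT_comp.
  - exact: measurableT_comp.
  - apply: filterS Sfin => x + Dx => /(_ Dx) Sx.
    by rewrite -[in leRHS](fineK Sx).
apply: filterS Sfin => x + Dx => /(_ Dx) Sx; split=> [n|].
  rewrite -lee_fin /= fineK//.
  have := @nneseries_lim_ge R (fun n => (e_ n x)%:E) xpredT 0 n.+1
    (fun k _ _ => e0' k x).
  apply: le_trans; rewrite big_nat_recr//= leeDr//; by apply: sume_ge0.
apply: (@fine_cvg _ _ _ _ (fun n => (e_ n x)%:E) 0).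
apply: (@squeeze_cvge _ _ _ _ (cst 0%E) _
   (fun N => \sum_(N <= k <oo) (e_ k x)%:E)%E).
- apply: nearW => n; rewrite lee_fin e0/=.
  have := @nneseries_lim_ge R (fun n => (e_ n x)%:E) xpredT n n.+1
    (fun k _ _ => e0' k x).
  by rewrite big_nat1.
- exact: cvg_cst.
- apply: nneseries_tail_cvg; last by move=> k _; rewrite lee_fin.
  by rewrite -ge0_fin_numE ?S0.
Qed.

End measure_lemmas.

(** * The Euclidean norm *)

Section enorm.
Context {R : realType} {n : nat}.
Implicit Types v w : 'rV[R]_n.

Lemma dotvv_ge0 v : 0 <= dotv v v.
Proof. by apply: sumr_ge0 => i _; rewrite -expr2 sqr_ge0. Qed.

Lemma enorm_ge0 v : 0 <= enorm v.
Proof. exact: sqrtr_ge0. Qed.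

Lemma sqr_enorm v : enorm v ^+ 2 = dotv v v.
Proof. by rewrite sqr_sqrtr// dotvv_ge0. Qed.

Lemma ler_enorm v i : `|v ord0 i| <= enorm v.
Proof.
rewrite -sqrtr_sqr ler_sqrt ?dotvv_ge0// /dotv (bigD1 i)//= -expr2 lerDl.
by apply: sumr_ge0 => j _; rewrite -expr2 sqr_ge0.
Qed.

Lemma enorm_le_sum v : enorm v <= \sum_i `|v ord0 i|.
Proof.
have S0 : 0 <= \sum_i `|v ord0 i| by apply: sumr_ge0.
rewrite -(ler_pXn2r (n := 2)) ?nnegrE ?enorm_ge0// sqr_enorm expr2 mulr_suml.
apply: ler_sum => i _; rewrite -expr2 -real_normK ?num_real// expr2.
by rewrite ler_wpM2l// (bigD1 i)//= lerDl sumr_ge0.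
Qed.

Lemma dotvC v w : dotv v w = dotv w v.
Proof. by apply: eq_bigr => i _; rewrite mulrC. Qed.

Lemma dotvDr v w w' : dotv v (w + w') = dotv v w + dotv v w'.
Proof. by rewrite /dotv -big_split; apply: eq_bigr => i _; rewrite mxE mulrDr. Qed.

Lemma dotvZr v (c : R) w : dotv v (c *: w) = c * dotv v w.
Proof. by rewrite /dotv mulr_sumr; apply: eq_bigr => i _; rewrite mxE mulrCA. Qed.

(** The quadratic polynomial c |-> |v + c w|^2 is nonnegative at its minimum. *)
Lemma dotv_CauchySchwarz v w : `|dotv v w| <= enorm v * enorm w.
Proof.
have key (c : R) : 0 <= dotv v v + 2 * c * dotv v w + c ^+ 2 * dotv w w.
  have := dotvv_ge0 (v + c *: w); rewrite dotvDr dotvZr !(dotvC (v + _)).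
  by rewrite !dotvDr !dotvZr (dotvC w v); congr (_ <= _); ring.
rewrite -(ler_pXn2r (n := 2)) ?nnegrE ?mulr_ge0 ?enorm_ge0//.
rewrite exprMn !sqr_enorm real_normK ?num_real//.
have [w0|wn0] := eqVneq (dotv w w) 0.
  suff -> : dotv v w = 0 by rewrite expr0n/= w0 mulr0.
  have wi0 i : w ord0 i = 0.
    apply/eqP; rewrite -sqrf_eq0 eq_le sqr_ge0 andbT -w0 /dotv.
    by rewrite (bigD1 i)//= -expr2 lerDl sumr_ge0// => j _; rewrite -expr2 sqr_ge0.
  by rewrite /dotv big1// => i _; rewrite wi0 mulr0.
have w_gt0 : 0 < dotv w w by rewrite lt_neqAle eq_sym wn0 dotvv_ge0.
have K := key (- (dotv v w / dotv w w)).
have := mulr_ge0 K (ltW w_gt0); move: (wn0); set a := dotv v v.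
set b := dotv v w; set c := dotv w w => c0.
suff -> : (a + 2 * - (b / c) * b + (- (b / c)) ^+ 2 * c) * c = a * c - b ^+ 2.
  by rewrite subr_ge0.
by field.
Qed.

Lemma measurable_dotv d (T : measurableType d) (D : set T) (G H : T -> 'rV[R]_n) :
  (forall i, measurable_fun D (fun x => G x ord0 i)) ->
  (forall i, measurable_fun D (fun x => H x ord0 i)) ->
  measurable_fun D (fun x => dotv (G x) (H x)).
Proof.
by move=> mG mH; apply: measurable_sum => i; exact: measurable_funM.
Qed.

Lemma measurable_enorm d (T : measurableType d) (D : set T) (G : T -> 'rV[R]_n) :
  (forall i, measurable_fun D (fun x => G x ord0 i)) ->
  measurable_fun D (fun x => enorm (G x)).
Proof.
move=> mG; apply: (@measurableT_comp _ _ _ _ _ _ (@Num.sqrt R)).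
  by apply: continuous_measurable_fun; exact: sqrt_continuous.
exact: measurable_dotv.
Qed.

(** The norm is at most [n] times the modulus of the largest coordinate. *)
Lemma powR_enorm_le v (p : R) : 0 < p ->
  enorm v `^ p <= n%:R `^ p * \sum_i `|v ord0 i| `^ p.
Proof.
move=> p0; have S0 : 0 <= \sum_i `|v ord0 i| `^ p.
  by apply: sumr_ge0 => i _; exact: powR_ge0.
have [i0|no] := pselect (inhabited 'I_n).
  have {i0}[i0] := i0.
  pose i := [arg max_(j > i0) `|v ord0 j|]%O.
  have iM j : `|v ord0 j| <= `|v ord0 i|.
    by rewrite /i; case: Order.TotalTheory.arg_maxP => // k _; apply.
  apply: (@le_trans _ _ ((n%:R * `|v ord0 i|) `^ p)).
    rewrite ge0_ler_powR ?nnegrE ?enorm_ge0 ?mulr_ge0 ?(ltW p0)//.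
    rewrite (le_trans (enorm_le_sum v))// (le_trans (ler_sum _ (fun j _ => iM j)))//.
    by rewrite sumr_const card_ord mulr_natl.
  rewrite powRM// ler_wpM2l ?powR_ge0// (bigD1 i)//= lerDl.
  by apply: sumr_ge0 => j _; exact: powR_ge0.
have -> : enorm v = 0.
  apply/eqP; rewrite eq_le enorm_ge0 andbT (le_trans (enorm_le_sum v))//.
  by rewrite big1// => i; case: no; exists.
by rewrite powR0 ?gt_eqF// mulr_ge0 ?powR_ge0.
Qed.

End enorm.

(** * Approximation of Sobolev functions by test functions *)

Section sobolev_approx.
Context {R : realType} {N : nat} (Omega : set 'rV[R]_N) (p : R).
Hypotheses (mOmega : measurable Omega) (p_gt0 : 0 < p).
Local Notation mu := (lebesgue_rV N).
Implicit Types (u f : 'rV[R]_N -> R).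

(** The power 0 `^ p vanishes because p > 0, so the extension by 0 outside Omega
    does not contribute. *)
Lemma Lp_norm_powR f :
  (Lp_norm Omega p f `^ p = \int[mu]_(x in Omega) (`|f x| `^ p)%:E)%E.
Proof.
rewrite /Lp_norm (poweR_Lnorm _ _ (lt0r_neq0 p_gt0)) [RHS]integral_mkcond.
apply: eq_integral => x _; rewrite [LHS](poweR_EFin `|(f \_ Omega) x|) /patch.
by case: ifPn => // _; rewrite normr0 powR0// gt_eqF.
Qed.

Lemma in_LpP f : in_Lp Omega p f <->
  measurable_fun Omega f /\ mu.-integrable Omega (fun x => (`|f x| `^ p)%:E).
Proof.
have powfin : (Lp_norm Omega p f < +oo)%E <->
   (\int[mu]_(x in Omega) (`|f x| `^ p)%:E < +oo)%E.
  rewrite -Lp_norm_powR; split; first exact: poweR_lty.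
  by apply: lty_poweRy; rewrite gt_eqF.
have mpow : measurable_fun Omega f -> measurable_fun Omega (fun x => `|f x| `^ p).
  move=> mf; apply: (@measurableT_comp _ _ _ _ _ _ (fun x => x `^ p)) => //.
  exact: measurableT_comp.
have absE : (\int[mu]_(x in Omega) `|(`|f x| `^ p)%:E| =
    \int[mu]_(x in Omega) (`|f x| `^ p)%:E)%E.
  by apply: eq_integral => x _; rewrite gee0_abs// lee_fin powR_ge0.
split=> [/andP[]|[mf /integrableP[_ fi]]].
  rewrite !inE/= => mf ff.
  have {}mf : measurable_fun Omega f by apply/(measurable_restrictT _ mOmega).
  split=> //; apply/integrableP; split; first by apply/measurable_EFinP; exact: mpow.
  by rewrite absE; apply/powfin.
apply/andP; rewrite !inE/=; split; first exact/(measurable_restrictT _ mOmega).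
by apply/powfin; rewrite -absE.
Qed.

Lemma W01p_measurable_integrable u G : W01p Omega p u G ->
  [/\ measurable_fun Omega u, mu.-integrable Omega (fun x => (`|u x| `^ p)%:E),
   (forall i, measurable_fun Omega (fun x => G x ord0 i)) &
   mu.-integrable Omega (fun x => (enorm (G x) `^ p)%:E)].
Proof.
move=> [[/in_LpP[mu' iu] iG _] _].
have mG i : measurable_fun Omega (fun x => G x ord0 i) by have /in_LpP[] := iG i.
split=> //.
have mE := measurable_enorm mG.
apply: (@integrable_dominated _ _ _ mu Omega mOmega (fun x => enorm (G x) `^ p)
  (fun x => N%:R `^ p * \sum_i `|G x ord0 i| `^ p)).
- exact: (@measurableT_comp _ _ _ _ _ _ (fun x => x `^ p)).
- rewrite (_ : EFin \o _ = (fun x => (N%:R `^ p)%:E * \sum_i (`|G x ord0 i| `^ p)%:E)%E).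
    apply: integrableZl => //; apply: integrable_sum => // i _.
    by have /in_LpP[] := iG i.
  by apply/funext => x /=; rewrite EFinM sumEFin.
- by move=> x _; rewrite ger0_norm ?powR_ge0// powR_enorm_le.
Qed.

End sobolev_approx.

Section sobolev_approx2.
Context {R : realType} {N : nat} (Omega : set 'rV[R]_N) (p : R).
Hypotheses (mOmega : measurable Omega) (p_gt0 : 0 < p).
Local Notation mu := (lebesgue_rV N).
Implicit Types (u f : 'rV[R]_N -> R).

Lemma Lp_norm_cvg0_near (f_ : nat -> 'rV[R]_N -> R) (e : R) : 0 < e ->
  Lp_norm Omega p (f_ k) @[k --> \oo] --> 0%E ->
  \forall k \near \oo, (\int[mu]_(x in Omega) (`|f_ k x| `^ p)%:E <= e%:E)%E.
Proof.
move=> e0 /fine_cvgP[fin cv0].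
have ep0 : 0 < e `^ p^-1 by rewrite powR_gt0.
near=> k.
have fink : Lp_norm Omega p (f_ k) \is a fin_num by near: k.
have ltk : fine (Lp_norm Omega p (f_ k)) < e `^ p^-1.
  by near: k; exact: (cvgr_lt _ cv0 _ ep0).
rewrite -Lp_norm_powR// -(fineK fink) poweR_EFin lee_fin.
have -> : e = (e `^ p^-1) `^ p by rewrite -powRrM mulVf ?gt_eqF// powRr1// ltW.
rewrite ge0_ler_powR ?nnegrE ?powR_ge0 ?(ltW p_gt0)//; last exact: ltW.
by rewrite fine_ge0// Lnorm_ge0.
Unshelve. all: by end_near. Qed.

Lemma test_function_continuous f : test_function Omega f -> continuous f.
Proof. by move=> [/(_ 0%N)]. Qed.

Lemma test_function_continuous_partial f i :
  test_function Omega f -> continuous (partial i f).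
Proof. by move=> [/(_ 1%N)[_ /(_ i)]]. Qed.

(** The approximations are chosen so fast that they converge almost everywhere
    together with their gradients, and that the p-th powers of the differences
    of the gradients have a common integrable bound. *)
Lemma W01p_approx u G : W01p Omega p u G ->
  exists (psi : nat -> 'rV[R]_N -> R) (H : 'rV[R]_N -> R),
  [/\ forall n, test_function Omega (psi n),
      mu.-integrable Omega (EFin \o H) &
      {ae mu, forall x, Omega x ->
        [/\ psi n x @[n --> \oo] --> u x,
            forall i, partial i (psi n) x @[n --> \oo] --> G x ord0 i &
            forall n, enorm (G x - grad (psi n) x) `^ p <= H x]}].
Proof.
move=> uG; have [mu' iu mG iG] := W01p_measurable_integrable mOmega p_gt0 uG.
case: uG => _ [phi [tphi cphi cgrad]].
(* Two terms of size 2^-(n+2) add up to 2^-(n+1), as [dominating_sum] asks. *)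
have ex n : exists psi, [/\ test_function Omega psi,
    (\int[mu]_(x in Omega) (`|u x - psi x| `^ p)%:E <= (2^-1 ^+ n.+2)%:E)%E &
    (\int[mu]_(x in Omega) (enorm (G x - grad psi x) `^ p)%:E <= (2^-1 ^+ n.+2)%:E)%E].
  have e0 : 0 < 2^-1 ^+ n.+2 :> R by rewrite exprn_gt0.
  have [k _ hk] : \forall k \near \oo,
    (\int[mu]_(x in Omega) (`|u x - phi k x| `^ p)%:E <= (2^-1 ^+ n.+2)%:E)%E /\
    (\int[mu]_(x in Omega) (`|enorm (G x - grad (phi k) x)| `^ p)%:E <= (2^-1 ^+ n.+2)%:E)%E.
    apply: filterI; first exact: Lp_norm_cvg0_near cphi.
    exact: Lp_norm_cvg0_near cgrad.
  have [h1 h2] := hk k (leqnn k); exists (phi k); split; [exact: tphi|exact: h1|].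
  by under eq_integral do rewrite -(ger0_norm (enorm_ge0 _)).
have [psi hpsi] := choice ex.
have mpsi n : measurable_fun Omega (psi n).
  by apply: continuous_rV_measurable_on; apply: test_function_continuous; have [] := hpsi n.
have mgrad n i : measurable_fun Omega (fun x => (grad (psi n) x) ord0 i).
  under eq_fun do rewrite mxE; apply: continuous_rV_measurable_on.
  by apply: test_function_continuous_partial; have [] := hpsi n.
have mdiff n i : measurable_fun Omega (fun x => (G x - grad (psi n) x) ord0 i).
  rewrite (_ : (fun x => _) = fun x => G x ord0 i - (grad (psi n) x) ord0 i).
    exact: measurable_funB.
  by apply/funext => x; rewrite !mxE.
pose e_ n x := `|u x - psi n x| `^ p + enorm (G x - grad (psi n) x) `^ p.
have m1 n : measurable_fun Omega (fun x => `|u x - psi n x| `^ p).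
  apply: (@measurableT_comp _ _ _ _ _ _ (fun x => x `^ p)) => //.
  by apply: measurableT_comp => //; exact: measurable_funB.
have m2 n : measurable_fun Omega (fun x => enorm (G x - grad (psi n) x) `^ p).
  apply: (@measurableT_comp _ _ _ _ _ _ (fun x => x `^ p)) => //.
  exact: measurable_enorm.
have [||n|H [iH aeH]] := @dominating_sum _ _ _ mu Omega mOmega e_.
- by move=> n; exact: measurable_funD.
- by move=> n x; rewrite addr_ge0 ?powR_ge0.
- rewrite /e_; under eq_integral do rewrite EFinD.
  have -> : (\int[mu]_(x in Omega) ((`|u x - psi n x| `^ p)%:E +
      (enorm (G x - grad (psi n) x) `^ p)%:E) =
      \int[mu]_(x in Omega) (`|u x - psi n x| `^ p)%:E +
      \int[mu]_(x in Omega) (enorm (G x - grad (psi n) x) `^ p)%:E)%E.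
    by apply: ge0_integralD; do [by []|by move=> x _; rewrite lee_fin powR_ge0|
      exact/measurable_EFinP].
  have [_ h1 h2] := hpsi n; apply: le_trans (leeD h1 h2) _.
  by rewrite -EFinD lee_fin (exprS _ n.+1); lra.
exists psi, H; split => //; first by move=> n; have [] := hpsi n.
apply: filterS aeH => x + Ox => /(_ Ox)[eH e0].
have cvg_root (b : nat -> R) (l : R) : (forall n, `|l - b n| `^ p <= e_ n x) ->
    b n @[n --> \oo] --> l.
  move=> be; apply/cvgrPdist_lt => eps eps0; have epsp : 0 < eps `^ p by rewrite powR_gt0.
  near=> n; have en : e_ n x < eps `^ p by near: n; exact: (cvgr_lt _ e0 _ epsp).
  rewrite ltNge; apply/negP => ea.
  have : eps `^ p <= `|l - b n| `^ p by rewrite ge0_ler_powR ?nnegrE// ltW.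
  by rewrite leNgt (le_lt_trans (be n) en).
split.
- by apply: cvg_root => n; rewrite lerDl powR_ge0.
- move=> i; apply: cvg_root => n.
  apply: (@le_trans _ _ (enorm (G x - grad (psi n) x) `^ p)).
    rewrite ge0_ler_powR ?nnegrE ?enorm_ge0 ?(ltW p_gt0)//.
    by have := ler_enorm (G x - grad (psi n) x) i; rewrite !mxE.
  by rewrite lerDr powR_ge0.
- by move=> n; rewrite (le_trans _ (eH n))// lerDr powR_ge0.
Unshelve. all: by end_near. Qed.

End sobolev_approx2.

(** * Test functions are Sobolev functions *)

Section test_functions.
Context {R : realType} {N : nat} (Omega : set 'rV[R]_N).
Local Notation mu := (lebesgue_rV N).
Implicit Types (f g : 'rV[R]_N -> R).

Lemma test_function_out f x : test_function Omega f -> ~ Omega x -> f x = 0.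
Proof.
move=> [_ _ sO] Ox; apply/eqP/negPn/negP => fx; apply/Ox/sO.
by apply: subset_closure => /=.
Qed.

Lemma partial_out_support f i x : ~ closure [set y | f y != 0] x ->
  partial i f x = 0.
Proof.
move=> cx; apply: near_eq0_partial.
have oC : open (~` closure [set y | f y != 0]).
  by apply: closed_openC; exact: closed_closure.
apply: filterS (open_nbhs_nbhs (conj oC cx)) => y cy.
apply/eqP/negPn/negP => fy; apply: cy; exact: subset_closure.
Qed.

Lemma test_function_partial_out f i x : test_function Omega f -> ~ Omega x ->
  partial i f x = 0.
Proof.
by move=> [_ _ sO] Ox; apply: partial_out_support => /sO.
Qed.

Lemma continuous_bounded_on_compact (K : set 'rV[R]_N) (h : 'rV[R]_N -> R) :
  compact K -> continuous h -> exists B : R, 0 <= B /\ forall x, K x -> `|h x| <= B.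
Proof.
move=> cK ch.
have /compact_bounded[M [_ hM]] := continuous_compact (continuous_subspaceT ch) cK.
exists (Num.max M 0 + 1); split.
  by rewrite addr_ge0// le_max lexx orbT.
move=> x Kx; apply: (hM (Num.max M 0 + 1)); last by exists x.
by rewrite (@le_lt_trans _ _ (Num.max M 0)) ?ltrDl// le_max lexx.
Qed.

Lemma test_function_bounded f : test_function Omega f ->
  exists B : R, (forall x, `|f x| <= B) /\ (forall i x, `|partial i f x| <= B).
Proof.
move=> tf; have [_ cS _] := tf.
have [B0 [B00 hB0]] := continuous_bounded_on_compact cS (test_function_continuous tf).
have /choice[B1 hB1] : forall i, exists B : R, 0 <= B /\
    forall x, closure [set y | f y != 0] x -> `|partial i f x| <= B.
  by move=> i; exact: continuous_bounded_on_compact cS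
       (test_function_continuous_partial (i := i) tf).
have S0 : 0 <= \sum_i B1 i by apply: sumr_ge0 => i _; have [] := hB1 i.
exists (B0 + \sum_i B1 i); split => [x|i x].
  have [fx0|fx] := eqVneq (f x) 0; first by rewrite fx0 normr0 addr_ge0.
  by rewrite (le_trans (hB0 x _)) ?lerDl//; exact: subset_closure.
have [cx|cx] := pselect (closure [set y | f y != 0] x); last first.
  by rewrite partial_out_support// normr0 addr_ge0.
have [_ h] := hB1 i; apply: le_trans (h x cx) _.
rewrite (bigD1 i)//= addrCA lerDl addr_ge0// sumr_ge0// => j _.
by have [] := hB1 j.
Qed.


Hypotheses (oOmega : open Omega) (fin_Omega : (mu Omega < +oo)%E).

Let mOmega : measurable Omega := open_rV_measurable oOmega.

Lemma integrable_bounded (h : 'rV[R]_N -> R) (B : R) :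
  measurable_fun Omega h -> (forall x, Omega x -> `|h x| <= B) ->
  mu.-integrable Omega (EFin \o h).
Proof.
move=> mh hB; apply: measurable_bounded_integrable => //.
exists B; split; first exact: num_real.
by move=> x Bx y Oy /=; rewrite (le_trans (hB y Oy))// ltW.
Qed.

(** The product f g has compact support, so its partial derivatives have
    integral 0. *)
Lemma integral_partial_test_mul f g i : test_function Omega f ->
  test_function Omega g ->
  \int[mu]_(x in Omega) (f x * partial i g x) =
  - \int[mu]_(x in Omega) (partial i f x * g x).
Proof.
move=> tf tg.
have cf := test_function_continuous tf.
have cg := test_function_continuous tg.
have cpf j := test_function_continuous_partial (i := j) tf.
have cpg j := test_function_continuous_partial (i := j) tg.
have df x : differentiable f x by have [/(_ 1%N)[]] := tf.
have dg x : differentiable g x by have [/(_ 1%N)[]] := tg.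
have [Bf [fB pfB]] := test_function_bounded tf.
have [Bg [gB pgB]] := test_function_bounded tg.
have pE j x : partial j (fun y => f y * g y) x = partial j f x * g x + f x * partial j g x.
  exact: partialM.
have i1 : mu.-integrable Omega (EFin \o (fun x => partial i f x * g x)).
  apply: (@integrable_bounded _ (Bf * Bg)).
    by apply: measurable_funM; exact: continuous_rV_measurable_on.
  by move=> x _; rewrite normrM ler_pM.
have i2 : mu.-integrable Omega (EFin \o (fun x => f x * partial i g x)).
  apply: (@integrable_bounded _ (Bf * Bg)).
    by apply: measurable_funM; exact: continuous_rV_measurable_on.
  by move=> x _; rewrite normrM ler_pM.
apply/eqP; rewrite -addr_eq0 addrC -RintegralD//; apply/eqP.
rewrite Rintegral_mkcond /Rintegral.
have [K fK] : exists K : R, forall (y : 'rV[R]_N) (k : 'I_N), K < `|y ord0 k| -> f y = 0.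
  have [_ cS _] := tf; have [M [_ hM]] := compact_bounded cS.
  exists (M + 1) => y k My; apply/eqP/negPn/negP => fy.
  have cy : closure [set x | f x != 0] y by exact: subset_closure.
  have := hM (M + 1); rewrite ltrDl ltr01 => /(_ isT y cy) /=.
  rewrite leNgt => /negP; apply; apply: (lt_le_trans My).
  rewrite /Num.norm/= mx_normrE.
  exact: (le_bigmax _ (fun ij : 'I_1 * 'I_N => `|y ij.1 ij.2|) (ord0, k)).
rewrite (eq_integral (fun x => (partial i (fun y => f y * g y) x)%:E)); last first.
  move=> x _; rewrite pE patchE; case: ifPn => //; rewrite notin_setE => Ox.
  by rewrite (test_function_out tf Ox) (test_function_partial_out _ tf Ox) !mul0r addr0.
rewrite (@integral_partial_compact _ _ _ K (Bf * Bg + Bf * Bg))//.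
- by move=> j x; apply: derivableM; exact: diff_derivable.
- move=> j; rewrite (_ : partial j _ = fun x => partial j f x * g x + f x * partial j g x).
    by move=> x; exact: (cvgD (cvgM (cpf j x) (cg x)) (cvgM (cf x) (cpg j x))).
  by apply/funext => x; exact: pE.
- by move=> y k Ky; rewrite (fK y k Ky) mul0r.
- move=> j x; rewrite pE (le_trans (ler_normD _ _))// lerD// normrM ler_pM//.
Qed.

(** The constant sequence serves as the approximating one; only the integration
    by parts needs an argument. *)
Lemma test_function_W01p (p : R) w : 1 < p -> test_function Omega w ->
  W01p Omega p w (grad w).
Proof.
move=> p1 tw; have p0 : 0 < p by rewrite (lt_trans _ p1).
have [B [wB pwB]] := test_function_bounded tw.
have inLp h : continuous h -> (forall x, `|h x| <= B) -> in_Lp Omega p h.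
  move=> ch hB; apply/(in_LpP mOmega p0).
  have mh : measurable_fun Omega h by exact: continuous_rV_measurable_on.
  split => //; apply: (@integrable_bounded (fun x => `|h x| `^ p) (B `^ p)).
    apply: (@measurableT_comp _ _ _ _ _ _ (fun x => x `^ p)) => //.
    exact: measurableT_comp.
  move=> x _; rewrite ger0_norm ?powR_ge0// ge0_ler_powR ?nnegrE// ?(ltW p0)//.
  by rewrite (le_trans _ (hB x)).
have norm0 : Lp_norm Omega p (fun=> 0) = 0%E.
  rewrite /Lp_norm (_ : _ \o _ = cst 0%E) ?Lnorm0 ?gt_eqF//.
  by apply/funext => x; rewrite /= /patch; case: ifP.
split; first split.
- by apply: inLp => //; exact: test_function_continuous tw.
- move=> i; rewrite (_ : (fun x => _) = partial i w); last first.
    by apply/funext => x; rewrite mxE.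
  by apply: inLp => //; exact: test_function_continuous_partial tw.
- move=> phi tphi i; rewrite (integral_partial_test_mul i tw tphi).
  by congr (- _); apply: eq_Rintegral => x _; rewrite mxE.
- exists (fun=> w); split => //.
  + rewrite (_ : (fun k => _) = fun=> 0%E); first exact: cvg_cst.
    by apply/funext => k; rewrite -norm0; congr Lp_norm; apply/funext => x; rewrite subrr.
  + rewrite (_ : (fun k => _) = fun=> 0%E); first exact: cvg_cst.
    apply/funext => k; rewrite -norm0; congr Lp_norm; apply/funext => x; rewrite subrr.
    by apply/eqP; rewrite sqrtr_eq0 /dotv big1// => j _; rewrite mxE mul0r.
Qed.

End test_functions.

(** * Testing an equation with composed functions *)

(** [A] can be composed with the approximations of Sobolev functions: smoothness
    is expressed through the preservation of the classes C^k in every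
    dimension, which is all that is needed of it and is stable under the
    operations that build [trunc]. *)
Definition smooth_bounded {R : realType} (A A' : R -> R) : Prop :=
  [/\ forall n k (f : 'rV[R]_n -> R), of_class_C k f -> of_class_C k (A \o f),
      forall s : R, is_derive s 1 A (A' s),
      continuous A' &
      exists M : R, forall s, `|A s| <= M /\ `|A' s| <= M].

(** A crude form of Young's inequality: bound the smaller of [a] and [b] by the
    larger one. *)
Lemma powR_young {R : realType} (p a b : R) : 1 < p -> 0 <= a -> 0 <= b ->
  a `^ (p - 2) * (a * b) <= a `^ p + b `^ p.
Proof.
move=> p1 a0 b0; have [->|an0] := eqVneq a 0.
  by rewrite mul0r mulr0 addr_ge0 ?powR_ge0.
have apos : 0 < a by rewrite lt_neqAle eq_sym an0.
have e1 : a `^ (p - 2) * a = a `^ (p - 1).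
  by rewrite -[X in _ * X]powRr1// -powRD ?an0 ?implybT//; congr powR; ring.
rewrite mulrA e1; have [ba|ab] := leP b a.
  rewrite (@le_trans _ _ (a `^ (p - 1) * a))//; first by rewrite ler_wpM2l ?powR_ge0.
  rewrite -[X in _ * X]powRr1// -powRD ?an0 ?implybT//.
  by rewrite (_ : p - 1 + 1 = p) ?lerDl ?powR_ge0//; ring.
have bpos : 0 < b by rewrite (lt_trans apos).
rewrite (@le_trans _ _ (b `^ (p - 1) * b))//.
  by rewrite ler_wpM2r// ge0_ler_powR ?nnegrE// ?subr_ge0 ltW.
rewrite -[X in _ * X]powRr1// -powRD ?(gt_eqF bpos) ?implybT//.
by rewrite (_ : p - 1 + 1 = p) ?lerDr ?powR_ge0//; ring.
Qed.

Section limit_test.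
Context {R : realType} {N : nat} (Omega : set 'rV[R]_N) (p : R).
Local Notation mu := (lebesgue_rV N).
Hypotheses (oOmega : open Omega) (fin_Omega : (mu Omega < +oo)%E) (p1 : 1 < p).

Let mOmega : measurable Omega := open_rV_measurable oOmega.
Let p0 : 0 < p. Proof. by rewrite (lt_trans _ p1). Qed.

(** Subtracting the value at (0, 0) makes the composite vanish where both [f]
    and [g] do, which keeps the support compact. *)
Lemma smooth_bounded_test (A A' B B' : R -> R) (f g : 'rV[R]_N -> R) :
  smooth_bounded A A' -> smooth_bounded B B' ->
  test_function Omega f -> test_function Omega g ->
  test_function Omega (fun x => A (f x) * B (g x) - A 0 * B 0).
Proof.
move=> [sA _ _ _] [sB _ _ _] [kf cf sf] [kg cg sg].
have sub : closure [set x | A (f x) * B (g x) - A 0 * B 0 != 0] `<=`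
   closure [set x | f x != 0] `|` closure [set x | g x != 0].
  rewrite -closureU; apply: closureS => x /= w0; apply: contrapT.
  move=> /not_orP[/negP/negPn/eqP fx /negP/negPn/eqP gx].
  by move: w0; rewrite fx gx subrr eqxx.
split.
- move=> k; apply: of_class_CD; last exact: of_class_C_cst.
  by apply: of_class_CM; [exact: sA|exact: sB].
- apply: subclosed_compact sub; first exact: closed_closure.
  exact: compactU.
- by apply: subset_trans sub _; rewrite subUset.
Qed.

Lemma smooth_bounded_grad (A A' B B' : R -> R) (f g : 'rV[R]_N -> R) x :
  smooth_bounded A A' -> smooth_bounded B B' ->
  test_function Omega f -> test_function Omega g ->
  grad (fun x => A (f x) * B (g x) - A 0 * B 0) x =
  (A' (f x) * B (g x)) *: grad f x + (A (f x) * B' (g x)) *: grad g x.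
Proof.
move=> [_ dA _ _] [_ dB _ _] tf tg.
have df : differentiable f x by have [/(_ 1%N)[]] := tf.
have dg : differentiable g x by have [/(_ 1%N)[]] := tg.
have dAf : differentiable (A \o f) x by exact: differentiable_comp_R df (dA _).
have dBg : differentiable (B \o g) x by exact: differentiable_comp_R dg (dB _).
apply/rowP => i; rewrite !mxE.
rewrite partialD; [|exact: differentiableM|exact: differentiable_cst].
rewrite [X in _ + X](_ : _ = 0) ?addr0; last by rewrite /partial derive_cst.
rewrite (@partialM _ _ i (A \o f) (B \o g))//.
rewrite (partial_comp i df (dA _)) (partial_comp i dg (dB _)) /=; ring.
Qed.

(** If [f] and [g] are limits of test functions, then an equation that holds for
    test functions may be tested with A(f) B(g) - A(0) B(0): the composites of
    the approximations are test functions, bounded independently of the index,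
    and dominated convergence applies on both sides. *)
Lemma limit_test_equation (A A' B B' : R -> R) (f g f0 : 'rV[R]_N -> R)
    (Gf Gg G : 'rV[R]_N -> 'rV[R]_N) :
  smooth_bounded A A' -> smooth_bounded B B' ->
  W01p Omega p f Gf -> W01p Omega p g Gg ->
  (forall i, measurable_fun Omega (fun x => G x ord0 i)) ->
  mu.-integrable Omega (fun x => (enorm (G x) `^ p)%:E) ->
  mu.-integrable Omega (EFin \o f0) ->
  (forall w, test_function Omega w ->
    plaplace_form Omega p G (grad w) = \int[mu]_(x in Omega) (f0 x * w x)) ->
  let X := fun x => enorm (G x) `^ (p - 2) * dotv (G x)
       ((A' (f x) * B (g x)) *: Gf x + (A (f x) * B' (g x)) *: Gg x) in
  let Y := fun x => f0 x * (A (f x) * B (g x) - A 0 * B 0) in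
  [/\ mu.-integrable Omega (EFin \o X), mu.-integrable Omega (EFin \o Y) &
   \int[mu]_(x in Omega) X x = \int[mu]_(x in Omega) Y x].
Proof.
move=> sA sB Wf Wg mG iG if0 eqn X Y.
have [mf _ mGf iGf] := W01p_measurable_integrable mOmega p0 Wf.
have [mg _ mGg iGg] := W01p_measurable_integrable mOmega p0 Wg.
have [fn [Hf [tf iHf aef]]] := W01p_approx mOmega p0 Wf.
have [gn [Hg [tg iHg aeg]]] := W01p_approx mOmega p0 Wg.
have [_ dA cA' [MA bA]] := sA; have [_ dB cB' [MB bB]] := sB.
have contA : continuous A.
  by move=> s; apply: differentiable_continuous; apply/derivable1_diffP; case: (dA s).
have contB : continuous B.
  by move=> s; apply: differentiable_continuous; apply/derivable1_diffP; case: (dB s).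
pose w n := (fun x => A (fn n x) * B (gn n x) - A 0 * B 0) : 'rV[R]_N -> R.
have tw n : test_function Omega (w n) by exact: smooth_bounded_test sA sB (tf n) (tg n).
pose M := MA * MB.
have MA0 : 0 <= MA by rewrite (le_trans _ (bA 0).1).
have MB0 : 0 <= MB by rewrite (le_trans _ (bB 0).1).
have bAB s t : `|A s * B t| <= M by rewrite normrM ler_pM ?(bA _).1 ?(bB _).1.
have bA'B s t : `|A' s * B t| <= M by rewrite normrM ler_pM ?(bA _).2 ?(bB _).1.
have bAB' s t : `|A s * B' t| <= M by rewrite normrM ler_pM ?(bA _).1 ?(bB _).2.
have M0 : 0 <= M by exact: mulr_ge0.
pose Xn n x := enorm (G x) `^ (p - 2) * dotv (G x) (grad (w n) x).
pose Yn n x := f0 x * w n x.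
have mR (h : R -> R) (k : 'rV[R]_N -> R) : continuous h -> measurable_fun Omega k ->
    measurable_fun Omega (fun x => h (k x)).
  by move=> ch mk; apply: (@measurableT_comp _ _ _ _ _ _ h) => //;
     exact: continuous_measurable_fun.
have mf0 : measurable_fun Omega f0.
  by have /integrableP[/measurable_EFinP] := if0.
have mpG : measurable_fun Omega (fun x => enorm (G x) `^ (p - 2)).
  apply: (@measurableT_comp _ _ _ _ _ _ (fun x => x `^ (p - 2))) => //.
  exact: measurable_enorm.
have mcoef (C D : R -> R) : continuous C -> continuous D ->
    measurable_fun Omega (fun x => C (f x) * D (g x)).
  by move=> cC cD; apply: measurable_funM; exact: mR.
have mX : measurable_fun Omega X.
  apply: measurable_funM => //; apply: measurable_dotv => // i.
  rewrite (_ : (fun x => _) = fun x => A' (f x) * B (g x) * Gf x ord0 i +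
    A (f x) * B' (g x) * Gg x ord0 i); last by apply/funext => x; rewrite !mxE.
  by apply: measurable_funD; apply: measurable_funM => //; exact: mcoef.
have mY : measurable_fun Omega Y.
  by apply: measurable_funM => //; apply: measurable_funB => //; exact: mcoef.
have mw n : measurable_fun Omega (w n).
  by apply: continuous_rV_measurable_on; exact: test_function_continuous (tw n).
have mYn n : measurable_fun Omega (Yn n) by exact: measurable_funM.
have mXn n : measurable_fun Omega (Xn n).
  apply: measurable_funM => //; apply: measurable_dotv => // i.
  rewrite (_ : (fun x => _) = partial i (w n)); last by apply/funext => x; rewrite mxE.
  by apply: continuous_rV_measurable_on; exact: test_function_continuous_partial (tw n).
have ccvg (h : R -> R) (a_ : nat -> R) (l : R) : continuous h ->
    a_ n @[n --> \oo] --> l -> h (a_ n) @[n --> \oo] --> h l.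
  by move=> ch ca; apply: continuous_cvg => //; exact: ch.
have cvgw : {ae mu, forall x, Omega x -> w n x @[n --> \oo] --> A (f x) * B (g x) - A 0 * B 0}.
  apply: filterS2 aef aeg => x hf hg Ox.
  have [cf _ _] := hf Ox; have [cg _ _] := hg Ox.
  apply: cvgB; last exact: cvg_cst.
  apply: cvgM; first exact: (ccvg _ _ _ contA cf).
  exact: (ccvg _ _ _ contB cg).
have [iY cY] : mu.-integrable Omega (EFin \o Y) /\
   \int[mu]_(x in Omega) Yn n x @[n --> \oo] --> \int[mu]_(x in Omega) Y x.
  apply: (@Rintegral_dominated _ _ _ mu Omega mOmega Yn Y (fun x => `|f0 x| * (M + M))) => //.
  - by apply: filterS cvgw => x h Ox; apply: cvgM; [exact: cvg_cst|exact: h].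
  - rewrite (_ : _ \o _ = (fun x => `|(EFin \o f0) x| * (M + M)%:E)%E)//.
    by apply: integrableZr => //; exact: integrable_abse.
  - apply: aeW => x Ox n; rewrite normrM ler_wpM2l//.
    by rewrite (le_trans (ler_normB _ _))// lerD.
have young a b : 0 <= a -> 0 <= b -> a `^ (p - 2) * (a * b) <= a `^ p + b `^ p.
  exact: powR_young.
(* The pairing with an approximate gradient z is split as v' - (v' - z), so
   that only the p-th powers of |v'| and |v' - z| enter. *)
have dotbound (v v' z : 'rV[R]_N) (h : R) : enorm (v' - z) `^ p <= h ->
    enorm v `^ (p - 2) * `|dotv v z| <= enorm v `^ p + enorm v' `^ p + (enorm v `^ p + h).
  move=> hh; have -> : dotv v z = dotv v v' + dotv v (- 1 *: (v' - z)).
    by rewrite -dotvDr scaleN1r opprB addrC subrK.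
  rewrite (@le_trans _ _ (enorm v `^ (p - 2) * (enorm v * enorm v') +
    enorm v `^ (p - 2) * (enorm v * enorm (v' - z))))//; last first.
    rewrite lerD ?young ?enorm_ge0//.
    by rewrite (le_trans (young _ _ _ _)) ?enorm_ge0// lerD2l.
  rewrite -mulrDr ler_wpM2l ?powR_ge0// (le_trans (ler_normD _ _))//.
  by rewrite dotvZr mulN1r normrN lerD// dotv_CauchySchwarz.
have [iX cX] : mu.-integrable Omega (EFin \o X) /\
   \int[mu]_(x in Omega) Xn n x @[n --> \oo] --> \int[mu]_(x in Omega) X x.
  apply: (@Rintegral_dominated _ _ _ mu Omega mOmega Xn X (fun x =>
    M * (enorm (G x) `^ p + enorm (Gf x) `^ p + (enorm (G x) `^ p + Hf x)) +
    M * (enorm (G x) `^ p + enorm (Gg x) `^ p + (enorm (G x) `^ p + Hg x)))) => //.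
  - apply: filterS2 aef aeg => x hf hg Ox.
    have [cf cGf _] := hf Ox; have [cg cGg _] := hg Ox.
    apply: cvgM; first exact: cvg_cst.
    apply: (cvg_big (op := +%R)) => [|i _]; first exact: add_continuous.
    apply: cvgM; first exact: cvg_cst.
    under eq_fun do rewrite (smooth_bounded_grad _ sA sB (tf _) (tg _)) !mxE.
    rewrite !mxE; apply: cvgD; apply: cvgM.
    + by apply: cvgM; [exact: (ccvg _ _ _ cA' cf)
                      |exact: (ccvg _ _ _ contB cg)].
    + exact: cGf.
    + by apply: cvgM; [exact: (ccvg _ _ _ contA cf)
                      |exact: (ccvg _ _ _ cB' cg)].
    + exact: cGg.
  - rewrite (_ : _ \o _ = (fun x =>
     M%:E * ((enorm (G x) `^ p)%:E + (enorm (Gf x) `^ p)%:E + ((enorm (G x) `^ p)%:E + (Hf x)%:E)) +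
     M%:E * ((enorm (G x) `^ p)%:E + (enorm (Gg x) `^ p)%:E + ((enorm (G x) `^ p)%:E + (Hg x)%:E)))%E)//.
    pose iS := @integrableD _ _ _ mu Omega mOmega.
    exact: (iS _ _ (integrableZl mOmega M (iS _ _ (iS _ _ iG iGf) (iS _ _ iG iHf)))
      (integrableZl mOmega M (iS _ _ (iS _ _ iG iGg) (iS _ _ iG iHg)))).
  - apply: filterS2 aef aeg => x hf hg Ox n.
    have [_ _ bf] := hf Ox; have [_ _ bg] := hg Ox.
    rewrite /Xn (smooth_bounded_grad _ sA sB (tf _) (tg _)) dotvDr !dotvZr.
    rewrite mulrDr (le_trans (ler_normD _ _))// lerD//.
      rewrite mulrCA !normrM [`|enorm _ `^ _|]ger0_norm ?powR_ge0//.
      by rewrite ler_pM ?mulr_ge0 ?powR_ge0// -?normrM ?bA'B// dotbound.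
    rewrite mulrCA !normrM [`|enorm _ `^ _|]ger0_norm ?powR_ge0//.
    by rewrite ler_pM ?mulr_ge0 ?powR_ge0// -?normrM ?bAB'// dotbound.
split=> //; apply: (cvg_unique (@Rhausdorff R) cX).
rewrite (_ : (fun n => _) = fun n => \int[mu]_(x in Omega) Yn n x)//.
by apply/funext => n; exact: eqn.
Qed.

End limit_test.

(** * A smooth bounded truncation *)

(** The convex function exp lies above its tangent at 0, here at the point
    ln x - ln y. A weighted sum of such inequalities is the weighted
    inequality between arithmetic and geometric means. *)
Lemma amgm_tangent {R : realType} (x y : R) : 0 < x -> 0 < y ->
  y * (1 + ln x - ln y) <= x.
Proof.
move=> x0 y0; have := expR_ge1Dx (ln x - ln y).
rewrite expRB !lnK ?posrE// ler_pdivlMr// mulrC addrA; exact.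
Qed.

(** Weighted means of y `^ a and 1, with the geometric mean y. *)
Lemma powR_bernoulli {R : realType} (y a : R) : 0 < y -> 1 <= a ->
  1 + a * (y - 1) <= y `^ a.
Proof.
move=> y0 a1; have a0 : 0 < a by rewrite (lt_le_trans ltr01).
have ya0 : 0 < y `^ a by rewrite powR_gt0.
have h1 := amgm_tangent ya0 y0; rewrite ln_powR in h1.
have h2 := amgm_tangent ltr01 y0; rewrite ln1 in h2.
have : (a - 1) * (y * (1 + 0 - ln y)) <= (a - 1) * 1 by rewrite ler_wpM2l ?subr_ge0.
move: h1; set l := ln y; set z := y `^ a; nra.
Qed.

Section truncation.
Context {R : realType} (M : R).
Hypothesis M1 : 1 <= M.
Implicit Types s t : R.

Let M0 : 0 < M. Proof. by rewrite (lt_le_trans ltr01). Qed.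

Definition trunc_exp s := M ^+ 3 * expR (M ^+ 2 * s).

(** With E = M^3 exp(M^2 s) this is M (1 - (1 + E)^(-1/M^3)) + 1/M. It is
    H(r(s)) + 1/M, where r(s) = ln(1 + E) / M^2 is a smooth positive part and
    H(r) = M (1 - exp(-r/M)) is concave, bounded and of slope 1 at 0. *)
Definition trunc s := M * (1 - (1 + trunc_exp s) `^ (- M ^- 3)) + M^-1.

Definition trunc' s := trunc_exp s * (1 + trunc_exp s) `^ (- M ^- 3 - 1).

Lemma trunc_exp_gt0 s : 0 < trunc_exp s.
Proof. by rewrite mulr_gt0 ?exprn_gt0 ?expR_gt0. Qed.

Lemma trunc_exp1_gt0 s : 0 < 1 + trunc_exp s.
Proof. by rewrite addr_gt0 ?trunc_exp_gt0. Qed.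

Lemma trunc_exp_ge s : 0 <= s -> M ^+ 3 <= trunc_exp s.
Proof.
by move=> s0; rewrite ler_peMr ?exprn_ge0 ?(ltW M0)// -expR0 ler_expR mulr_ge0 ?exprn_ge0 ?(ltW M0).
Qed.

Lemma trunc_powR s : (1 + trunc_exp s) `^ (- M ^- 3) = expR (- (M ^- 3 * ln (1 + trunc_exp s))).
Proof. by rewrite /powR gt_eqF ?trunc_exp1_gt0// mulNr. Qed.

Lemma trunc_powR_le1 s : (1 + trunc_exp s) `^ (- M ^- 3) <= 1.
Proof.
rewrite trunc_powR -[leRHS]expR0 ler_expR oppr_le0 mulr_ge0 ?invr_ge0 ?exprn_ge0 ?(ltW M0)//.
by rewrite ln_ge0 ?lerDl ?ltW ?trunc_exp_gt0.
Qed.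

Lemma trunc_ge_inv s : M^-1 <= trunc s.
Proof. by rewrite /trunc lerDr mulr_ge0 ?(ltW M0)// subr_ge0 trunc_powR_le1. Qed.

Lemma trunc_gt0 s : 0 < trunc s.
Proof. by rewrite (lt_le_trans _ (trunc_ge_inv s)) ?invr_gt0. Qed.

Lemma trunc_le_level s : trunc s <= M + M^-1.
Proof.
by rewrite /trunc lerD2r ler_piMr ?(ltW M0)// gerBl powR_ge0.
Qed.

Lemma trunc'E s : trunc' s =
  (trunc_exp s / (1 + trunc_exp s)) * (1 + trunc_exp s) `^ (- M ^- 3).
Proof.
rewrite /trunc' powRD ?(gt_eqF (trunc_exp1_gt0 s)) ?implybT//.
by rewrite powR_inv1 ?(ltW (trunc_exp1_gt0 _))// mulrA mulrAC.
Qed.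

Lemma trunc'_ge0 s : 0 <= trunc' s.
Proof. by rewrite mulr_ge0 ?powR_ge0// ltW ?trunc_exp_gt0. Qed.

Lemma trunc'_le1 s : trunc' s <= 1.
Proof.
rewrite trunc'E mulr_ile1 ?powR_ge0 ?trunc_powR_le1//.
  by rewrite divr_ge0 ?ltW ?trunc_exp_gt0 ?trunc_exp1_gt0.
by rewrite ler_pdivrMr ?trunc_exp1_gt0// mul1r lerDr.
Qed.

(** This is the concavity of [trunc M] on [0, +oo). As a function of E,
    ln(E (1 + E)^(-k-1)) with k = M^(-3) decreases as soon as k E >= 1, which
    holds for s >= 0 because of the factor M^3 in [trunc_exp]. *)
Lemma trunc'_nincr s t : 0 <= s -> s <= t -> trunc' t <= trunc' s.
Proof.
move=> s0 st; rewrite /trunc'.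
have Es := trunc_exp_gt0 s; have Et := trunc_exp_gt0 t.
have Est : trunc_exp s <= trunc_exp t.
  by rewrite ler_pM2l ?exprn_gt0// ler_expR ler_pM2l ?exprn_gt0.
have KE : 1 <= M ^- 3 * trunc_exp s.
  by rewrite -ler_pdivrMl ?invr_gt0 ?exprn_gt0// invrK mulr1 trunc_exp_ge.
have k0 : 0 < M ^- 3 by rewrite invr_gt0 exprn_gt0.
move: (trunc_exp1_gt0 s) (trunc_exp1_gt0 t) Es Et Est KE k0.
move: (trunc_exp s) (trunc_exp t) (M ^- 3) => E F k E10 F10 E0 F0 EF KE k0.
have y0 : 0 < (1 + F) / (1 + E) by rewrite divr_gt0.
have ber := powR_bernoulli y0 (_ : 1 <= k + 1); rewrite lerDr (ltW k0) in ber.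
have {}ber := ber isT.
(* Bernoulli at y = (1 + F)/(1 + E) with exponent k + 1, and k E >= 1. *)
have FE : F / E <= ((1 + F) / (1 + E)) `^ (k + 1).
  apply: le_trans ber; rewrite ler_pdivrMr//.
  rewrite -subr_ge0.
  have -> : (1 + (k + 1) * ((1 + F) / (1 + E) - 1)) * E - F =
     (F - E) * (k * E - 1) / (1 + E) by field; rewrite gt_eqF.
  by rewrite divr_ge0 ?mulr_ge0 ?subr_ge0// ltW.
rewrite -opprD !powRN.
rewrite powRM ?invr_ge0 ?(ltW F10) ?(ltW E10)// ler_pdivrMr// in FE.
move: FE; rewrite -[(1 + E)^-1]powR_inv1 ?(ltW E10)// -powRrM mulN1r powRN.
have := powR_gt0 (k + 1) F10; have := powR_gt0 (k + 1) E10.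
set a := _ `^ _; set b := _ `^ _ => a0 b0 FE.
rewrite ler_pdivrMr//; apply: le_trans FE _; rewrite le_eqVlt; apply/orP; left.
by apply/eqP; ring.
Qed.


(** 1 + M^3 <= (1 + M)^3 and ln(1 + M) <= M. *)
Lemma trunc_ln_le s : 0 <= s ->
  ln (1 + trunc_exp s) <= M ^+ 2 * s + 3 * M.
Proof.
move=> s0; have e1 : 1 <= expR (M ^+ 2 * s).
  by rewrite -[leLHS]expR0 ler_expR mulr_ge0// exprn_ge0// ltW.
have M1' : 0 < 1 + M by rewrite addr_gt0.
apply: (@le_trans _ _ (ln (expR (M ^+ 2 * s) * (1 + M) ^+ 3))).
  rewrite ler_ln ?posrE ?trunc_exp1_gt0 ?mulr_gt0 ?expR_gt0 ?exprn_gt0//.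
  rewrite /trunc_exp; have : 1 + M ^+ 3 <= (1 + M) ^+ 3.
    have M00 := ltW M0; rewrite -subr_ge0 (_ : _ - _ = 3 * M + 3 * M ^+ 2); last by ring.
    by rewrite addr_ge0 ?mulr_ge0 ?exprn_ge0.
  have M30 : 0 < M ^+ 3 by rewrite exprn_gt0.
  move: e1; set e := expR _; set a := M ^+ 3; set b := (1 + M) ^+ 3; nra.
rewrite lnM ?posrE ?expR_gt0 ?exprn_gt0// expRK lerD2l lnXn//.
have lM : ln (1 + M) <= M by rewrite -ler_expR lnK ?posrE// expR_ge1Dx.
rewrite -[leLHS]mulr_natl; nra.
Qed.

Lemma trunc_ln_ge s : M ^+ 2 * s <= ln (1 + trunc_exp s).
Proof.
rewrite -[leLHS]expRK ler_ln ?posrE ?expR_gt0 ?trunc_exp1_gt0//.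
rewrite /trunc_exp ler_wpDl// ler_peMl ?expR_ge0// exprn_ege1//.
Qed.

(** 1 - exp(-y) <= y with y = M^(-3) ln(1 + E). *)
Lemma trunc_le s : 0 <= s -> trunc s <= s + 4 / M.
Proof.
move=> s0; have := expR_ge1Dx (- (M ^- 3 * ln (1 + trunc_exp s))).
rewrite /trunc trunc_powR; have := trunc_ln_le s0.
set L := ln _; set e := expR _ => Ls eL.
have : M * (1 - e) <= M * (M ^- 3 * L) by rewrite ler_pM2l//; lra.
have -> : M * (M ^- 3 * L) = L / M ^+ 2 by field; rewrite gt_eqF.
have : L / M ^+ 2 <= (M ^+ 2 * s + 3 * M) / M ^+ 2 by rewrite ler_pM2r ?invr_gt0 ?exprn_gt0.
have -> : (M ^+ 2 * s + 3 * M) / M ^+ 2 = s + 3 / M by field; rewrite gt_eqF.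
have -> : 4 / M = 3 / M + M^-1 by field; rewrite gt_eqF.
lra.
Qed.

(** 1 - exp(-y) >= 1 - 1/(1 + y), and y >= s/M. *)
Lemma trunc_ge s : 0 <= s -> s / (1 + s / M) <= trunc s.
Proof.
move=> s0; have L0 : 0 <= M ^- 3 * ln (1 + trunc_exp s).
  rewrite mulr_ge0 ?invr_ge0 ?exprn_ge0 ?(ltW M0)// ln_ge0// lerDl ltW//.
  exact: trunc_exp_gt0.
have := expR_ge1Dx (M ^- 3 * ln (1 + trunc_exp s)).
have : s / M <= M ^- 3 * ln (1 + trunc_exp s).
  rewrite (_ : s / M = M ^- 3 * (M ^+ 2 * s)); last by field; rewrite gt_eqF.
  by rewrite ler_pM2l ?invr_gt0 ?exprn_gt0// trunc_ln_ge.
rewrite /trunc trunc_powR expRN; have := expR_gt0 (M ^- 3 * ln (1 + trunc_exp s)).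
set e := expR _; set y := M ^- 3 * _ => e0 sy ye.
have sM0 : 0 <= s / M by rewrite divr_ge0// ltW.
have s1 : 0 < 1 + s / M by lra.
have -> : s / (1 + s / M) = M * (1 - (1 + s / M)^-1) by field; rewrite (gt_eqF M0) /= gt_eqF// ltr_wpDr.
rewrite -[leLHS]addr0 lerD ?invr_ge0 ?(ltW M0)// ler_pM2l// lerD2l lerN2.
by rewrite lef_pV2 ?posrE//; lra.
Qed.

(** The slope is the product of E / (1 + E) >= 1 - 1/M and
    exp(-y) >= 1 - y. *)
Lemma trunc'_ge s : 0 <= s -> 1 - (s / M + 4 / M) <= trunc' s.
Proof.
move=> s0; rewrite trunc'E trunc_powR.
have := expR_ge1Dx (- (M ^- 3 * ln (1 + trunc_exp s))).
have e1 := trunc_powR_le1 s; rewrite trunc_powR in e1.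
have Ege := trunc_exp_ge s0; have E0 := trunc_exp_gt0 s; have E1 := trunc_exp1_gt0 s.
have : M ^- 3 * ln (1 + trunc_exp s) <= s / M + 3 / M.
  apply: (@le_trans _ _ (M ^- 3 * (M ^+ 2 * s + 3 * M))).
    by rewrite ler_pM2l ?invr_gt0 ?exprn_gt0// trunc_ln_le.
  rewrite (_ : M ^- 3 * (M ^+ 2 * s + 3 * M) = s / M + 3 / M / M); last by field; rewrite gt_eqF.
  by rewrite lerD2l ler_pdivrMr// ler_peMr// divr_ge0// ltW.
have : 1 - M^-1 <= trunc_exp s / (1 + trunc_exp s).
  rewrite ler_pdivlMr//.
  have ME : M^-1 * (1 + trunc_exp s) >= 1.
    rewrite -ler_pdivrMl ?invr_gt0// invrK mulr1.
    rewrite (le_trans _ (_ : M ^+ 3 <= _))//; last by rewrite (le_trans Ege)// lerDr.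
    by rewrite exprS ler_peMr ?(ltW M0)// exprn_ege1.
  lra.
have -> : 4 / M = 3 / M + M^-1 by field; rewrite gt_eqF.
move: e1; set L := M ^- 3 * _; set e := expR _; set r := trunc_exp s / _.
have e0 : 0 <= e by exact: expR_ge0.
have iM0 : 0 <= M^-1 by rewrite invr_ge0 ltW.
move: e0 iM0; set i := M^-1; set u := s * i; set v := 3 * i => *; nra.
Qed.

End truncation.

Section truncation_smooth.
Context {R : realType} (M : R).
Hypothesis M1 : 1 <= M.
Implicit Types s t : R.

Let M0 : 0 < M. Proof. by rewrite (lt_le_trans ltr01). Qed.

Lemma is_derive_trunc_exp s : is_derive s (1 : R) (trunc_exp M) (M ^+ 2 * trunc_exp M s).
Proof.
have d1 : is_derive s (1 : R) (fun x => M ^+ 2 * x) (M ^+ 2).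
  by apply: is_derive_eq; rewrite /GRing.scale /= mulr1.
have d2 : is_derive s (1 : R) (expR \o (fun x => M ^+ 2 * x)) (expR (M ^+ 2 * s) * M ^+ 2).
  by apply: is_derive1_comp.
have d3 := @is_deriveZ _ _ _ (expR \o (fun x => M ^+ 2 * x)) (M ^+ 3) s 1 _ d2.
apply: (is_derive_eq d3).
by rewrite /trunc_exp /GRing.scale /=; ring.
Qed.

Lemma is_derive_trunc s : is_derive s (1 : R) (trunc M) (trunc' M s).
Proof.
have dE := is_derive_trunc_exp s.
have d1 : is_derive s (1 : R) (cst 1 + trunc_exp M) (M ^+ 2 * trunc_exp M s).
  by apply: is_derive_eq; rewrite add0r.
have d2 : is_derive s (1 : R) ((fun y : R => y `^ (- M ^- 3)) \o (cst 1 + trunc_exp M))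
   ((- M ^- 3 * (1 + trunc_exp M s) `^ (- M ^- 3 - 1)) * (M ^+ 2 * trunc_exp M s)).
  apply: is_derive1_comp; apply: is_derive1_powR; exact: trunc_exp1_gt0.
have d3 := is_deriveB (is_derive_cst (1 : R) s (1 : R)) d2.
have d4 := @is_deriveZ _ _ _ _ M s 1 _ d3.
have d5 := is_deriveD d4 (is_derive_cst M^-1 s (1 : R)).
apply: (is_derive_eq d5).
by rewrite /trunc' /GRing.scale /=; field; rewrite gt_eqF.
Qed.

Lemma trunc_continuous : continuous (trunc M).
Proof.
move=> s; apply: differentiable_continuous; apply/derivable1_diffP.
by case: (is_derive_trunc s).
Qed.

Lemma of_class_C_trunc n k (f : 'rV[R]_n -> R) :
  of_class_C k f -> of_class_C k (trunc M \o f).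
Proof.
move=> cf.
have cE : of_class_C k (trunc_exp M \o f).
  apply: of_class_CM; first exact: of_class_C_cst.
  apply: (@of_class_C_expR _ _ k (fun x => M ^+ 2 * f x)).
  by apply: of_class_CM => //; exact: of_class_C_cst.
have cE1 : of_class_C k (fun x => 1 + trunc_exp M (f x)).
  by apply: of_class_CD => //; exact: of_class_C_cst.
have cP := of_class_C_powR (- M ^- 3) (fun x => trunc_exp1_gt0 M1 (f x)) cE1.
rewrite (_ : _ \o _ = fun x => M * (1 + (-1) * (1 + trunc_exp M (f x)) `^ (- M ^- 3)) + M^-1).
  apply: of_class_CD; last exact: of_class_C_cst.
  apply: of_class_CM; first exact: of_class_C_cst.
  apply: of_class_CD; first exact: of_class_C_cst.
  by apply: of_class_CM; first exact: of_class_C_cst.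
by apply/funext => x; rewrite /= /trunc mulN1r.
Qed.

Lemma trunc'_continuous : continuous (trunc' M).
Proof.
have cE : continuous (fun s => trunc_exp M s).
  move=> s; apply: differentiable_continuous; apply/derivable1_diffP.
  by case: (is_derive_trunc_exp s).
move=> s; apply: cvgM; first exact: cE.
apply: (@continuous_comp _ _ _ (fun s => 1 + trunc_exp M s) (fun y : R => y `^ (- M ^- 3 - 1))).
  by apply: cvgD; [exact: cvg_cst|exact: cE].
apply: differentiable_continuous; apply/derivable1_diffP.
by case: (is_derive1_powR (- M ^- 3 - 1) (trunc_exp1_gt0 M1 s)).
Qed.

Lemma trunc_powR_le (r : R) s : trunc M s `^ r <= M^-1 `^ r + (M + M^-1) `^ r.
Proof.
have t0 := trunc_gt0 M1 s; have tl := trunc_ge_inv M1 s; have tu := trunc_le_level M1 s.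
have Mi0 : 0 < M^-1 by rewrite invr_gt0.
have MM0 : 0 < M + M^-1 by rewrite addr_gt0.
have [r0|r0] := leP 0 r.
  apply: (@le_trans _ _ ((M + M^-1) `^ r)); last by rewrite lerDr powR_ge0.
  by rewrite ge0_ler_powR ?nnegrE// ltW.
apply: (@le_trans _ _ (M^-1 `^ r)); last by rewrite lerDl powR_ge0.
rewrite -(opprK r) !(powRN _ (- r)) lef_pV2 ?posrE ?powR_gt0//.
by rewrite ge0_ler_powR ?nnegrE ?oppr_ge0// ltW.
Qed.

(** All powers of [trunc M] qualify because it stays between two positive
    constants. *)
Lemma smooth_bounded_trunc (r : R) :
  smooth_bounded (fun s => trunc M s `^ r) (fun s => r * trunc M s `^ (r - 1) * trunc' M s).
Proof.
have dP (r' : R) s : is_derive s (1 : R) (fun s => trunc M s `^ r')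
    (r' * trunc M s `^ (r' - 1) * trunc' M s).
  apply: (@is_derive1_comp _ (fun y : R => y `^ r') (trunc M)); last exact: is_derive_trunc.
  by apply: is_derive1_powR; exact: trunc_gt0.
split.
- move=> n k f cf.
  by apply: (@of_class_C_powR _ _ k (trunc M \o f)) => [x|]; [exact: trunc_gt0|exact: of_class_C_trunc].
- by [].
- move=> s; apply: cvgM; last exact: trunc'_continuous.
  have cP : {for s, continuous (fun s => trunc M s `^ (r - 1))}.
    have [/derivable1_diffP dP' _] := dP (r - 1) s.
    exact: differentiable_continuous dP'.
  apply: cvgM; first exact: cvg_cst.
  exact: cP.
- pose K r' := M^-1 `^ r' + (M + M^-1) `^ r'.
  have K0 r' : 0 <= K r' by rewrite addr_ge0 ?powR_ge0.
  exists (K r + `|r| * K (r - 1)) => s; split.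
    rewrite ger0_norm ?powR_ge0// (le_trans (trunc_powR_le r s))// lerDl mulr_ge0//.
  rewrite normrM (normrM r) (ger0_norm (trunc'_ge0 M1 s)) [`|_ `^ _|]ger0_norm ?powR_ge0//.
  rewrite (@le_trans _ _ (`|r| * K (r - 1)))// ?lerDr// -mulrA ler_wpM2l//.
  rewrite -[leRHS]mulr1 ler_pM ?powR_ge0 ?trunc'_ge0 ?trunc'_le1//.
  exact: trunc_powR_le.
Qed.

End truncation_smooth.

Section truncation_limit.
Context {R : realType}.

Lemma trunc_level_ge1 n : 1 <= n.+1%:R :> R.
Proof. by rewrite ler1n. Qed.

Lemma cvg_trunc (s : R) : 0 <= s -> trunc n.+1%:R s @[n --> \oo] --> s.
Proof.
move=> s0; have inv0 := @cvg_harmonic R.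
apply: (@squeeze_cvgr _ _ _ _ (fun n => s / (1 + s / n.+1%:R)) (fun n => s + 4 / n.+1%:R)).
- apply: nearW => n; rewrite trunc_ge ?trunc_le//; exact: trunc_level_ge1.
- rewrite -[X in _ --> X](_ : s / (1 + s * 0) = s); last by rewrite mulr0 addr0 divr1.
  apply: cvgM; first exact: cvg_cst.
  apply: cvgV; first by rewrite mulr0 addr0 oner_eq0.
  by apply: cvgD; [exact: cvg_cst|apply: cvgM; [exact: cvg_cst|exact: inv0]].
- rewrite -[X in _ --> X](_ : s + 4 * 0 = s); last by rewrite mulr0 addr0.
  by apply: cvgD; [exact: cvg_cst|apply: cvgM; [exact: cvg_cst|exact: inv0]].
Qed.

Lemma cvg_trunc' (s : R) : 0 <= s -> trunc' n.+1%:R s @[n --> \oo] --> (1 : R).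
Proof.
move=> s0; have inv0 := @cvg_harmonic R.
apply: (@squeeze_cvgr _ _ _ _ (fun n => 1 - (s / n.+1%:R + 4 / n.+1%:R)) (fun=> 1)).
- apply: nearW => n; rewrite trunc'_ge ?trunc'_le1//; exact: trunc_level_ge1.
- rewrite -[X in _ --> X](_ : 1 - (s * 0 + 4 * 0) = 1); last by rewrite !mulr0 addr0 subr0.
  apply: cvgB; first exact: cvg_cst.
  by apply: cvgD; (apply: cvgM; [exact: cvg_cst|exact: inv0]).
- exact: cvg_cst.
Qed.

End truncation_limit.

#[global] Opaque trunc trunc'.

(** * The pointwise Picone inequality *)

Section picone.
Context {R : realType} (p q : R).
Hypotheses (q_gt1 : 1 < q) (q_lt_p : q < p).
Hypothesis pq_cond : forall s : R, 0 <= s ->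
  0 <= (q - 1) * s `^ p + q * s `^ (p - 1) - (p - q) * s + (q - p + 1).

(** The assumption on p and q at s = 0. *)
Lemma pq_gap : 0 <= q - p + 1.
Proof.
have q1 := q_gt1; have qp := q_lt_p.
have := pq_cond (lexx 0).
have p0 : 0 < p by lra.
have p10 : 0 < p - 1 by lra.
by rewrite !powR0 ?gt_eqF// !mulr0 subr0 !add0r.
Qed.

(** The expression is affine in [c], so that it suffices to treat c = -1, which
    is the assumption on p and q, and c = 1. There it is the weighted inequality
    between arithmetic and geometric means for 1, s and s `^ p with weights
    (q-p+1)/q, (p-q)/q and (q-1)/q, whose geometric mean is s `^ (p-1). *)
Lemma picone_scalar (s c : R) : 0 < s -> `|c| <= 1 ->
  0 <= (q - p + 1) + (p - q) * s * c - q * s `^ (p - 1) * c + (q - 1) * s `^ p.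
Proof.
have q1 := q_gt1; have qp := q_lt_p.
move=> s0; rewrite ler_norml => /andP[c1 c2].
have h1 := pq_cond (ltW s0).
have S1 : 0 < s `^ (p - 1) by rewrite powR_gt0.
have S0 : 0 < s `^ p by rewrite powR_gt0.
have h2 : 0 <= (q - 1) * s `^ p - q * s `^ (p - 1) + (p - q) * s + (q - p + 1).
  have a1 := amgm_tangent ltr01 S1; have a2 := amgm_tangent s0 S1.
  have a3 := amgm_tangent S0 S1; rewrite !ln_powR ?ln1 in a1 a2 a3.
  have gap := pq_gap; have pq0 : 0 <= p - q by lra.
  have q10 : 0 <= q - 1 by lra.
  have := ler_wpM2l gap a1; have := ler_wpM2l pq0 a2; have := ler_wpM2l q10 a3.
  set S := s `^ p; set T := s `^ (p - 1); set l := ln s => b3 b2 b1.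
  have : (q - p + 1) * (T * (1 + 0 - (p - 1) * l)) + (p - q) * (T * (1 + l - (p - 1) * l)) +
    (q - 1) * (T * (1 + p * l - (p - 1) * l)) = q * T by ring.
  lra.
move: h1 h2; set S := s `^ p; set T := s `^ (p - 1) => h1 h2.
set h := (X in 0 <= X).
have -> : h = (1 + c) / 2 * ((q - 1) * S - q * T + (p - q) * s + (q - p + 1)) +
  (1 - c) / 2 * ((q - 1) * S + q * T - (p - q) * s + (q - p + 1)) by rewrite /h; field.
by rewrite addr_ge0// mulr_ge0//; lra.
Qed.

(** The linear term wins only for bounded [s], because p > 1; recall that
    p - q <= 1. *)
Lemma absorbing_constant : exists2 C : R, 0 <= C &
  forall s, 0 < s -> (p - q) * s <= (q - 1) * s `^ p + C.
Proof.
have q1 := q_gt1; have qp := q_lt_p.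
have q10 : 0 < q - 1 by lra.
have p10 : 0 < p - 1 by lra.
have gap := pq_gap.
exists ((q - 1)^-1 `^ (p - 1)^-1) => [|s s0]; first exact: powR_ge0.
set K := (q - 1)^-1 `^ (p - 1)^-1; have K0 : 0 <= K by exact: powR_ge0.
have sp : s `^ p = s * s `^ (p - 1).
  rewrite -[X in X * _]powRr1 ?(ltW s0)// -powRD ?(gt_eqF s0) ?implybT//.
  by congr powR; ring.
have pqs : (p - q) * s <= s by rewrite ler_piMl ?(ltW s0)//; lra.
have [Ks|sK] := leP K s; last first.
  apply: (le_trans pqs); apply: (le_trans (ltW sK)).
  by rewrite lerDr mulr_ge0 ?powR_ge0// ltW.
have : 1 <= (q - 1) * s `^ (p - 1).
  rewrite -ler_pdivrMl// mulr1 (_ : (q - 1)^-1 = K `^ (p - 1)); last first.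
    by rewrite /K -powRrM mulVf ?gt_eqF// powRr1// invr_ge0 ltW.
  by rewrite ge0_ler_powR ?nnegrE// ltW.
move=> /(ler_wpM2l (ltW s0)); rewrite mulr1 mulrCA -sp => sS.
by rewrite (le_trans pqs)// (le_trans sS)// lerDl.
Qed.

(** Here x = |Du|, y = |Dphi|, d = Du . Dphi, m = g(phi), v = g(u), and [al],
    [be] are the slopes of the truncation g at [phi] and at [u]. For equal
    slopes the inequality is [picone_scalar]. In general the smaller slope is
    split off. If al > be, what remains is at least
    -(al - be) q x^(p-1) y (m/v)^(q-1) with m <= v; if be > al, it is at least
    -(be - al) C y^p (m/v)^(q-p), by [absorbing_constant], with v <= m. In both
    cases the power of m/v is at most 1. *)
Lemma picone_pointwise : exists2 C : R, 0 <= C &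
  forall x y d m v al be : R, 0 <= x -> 0 <= y -> `|d| <= x * y ->
  0 < m -> 0 < v -> 0 <= al <= 1 -> 0 <= be <= 1 ->
  (m <= v /\ be <= al) \/ (v <= m /\ al <= be) ->
  x `^ (p - 2) * (q * m `^ (q - 1) * al * v `^ (1 - q) * d +
                  m `^ q * ((1 - q) * v `^ (1 - q - 1) * be) * x ^+ 2) <=
  y `^ (p - 2) * ((q - p + 1) * m `^ (q - p + 1 - 1) * al * v `^ (p - q) * y ^+ 2 +
                  m `^ (q - p + 1) * ((p - q) * v `^ (p - q - 1) * be) * d) +
  (C * (y `^ p * (1 - al)) + q * (x `^ (p - 2) * (x * y) * (1 - be))).
Proof.
have q1 := q_gt1; have qp := q_lt_p.
have [C C0 hC] := absorbing_constant; exists C => //.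
move=> x y d m v al be x0 y0 dxy m0 v0 /andP[al0 al1] /andP[be0 be1] mv.
have gap := pq_gap; have q0 : 0 < q by lra.
have pq0 : 0 <= p - q by lra.
(* If d = 0, in particular if x or y vanishes, the sides have opposite signs. *)
have [->|dn0] := eqVneq d 0.
  rewrite !mulr0 add0r addr0.
  apply: (@le_trans _ _ 0).
    rewrite mulr_ge0_le0 ?powR_ge0// mulr_le0_ge0 ?sqr_ge0//.
    rewrite mulr_ge0_le0 ?powR_ge0// mulr_le0_ge0// mulr_le0_ge0 ?powR_ge0//; lra.
  by rewrite !addr_ge0 ?mulr_ge0 ?powR_ge0 ?sqr_ge0 ?subr_ge0// ltW.
have xy0 : 0 < x * y by rewrite (lt_le_trans _ dxy)// normr_gt0.
have xn0 : x != 0 by apply/eqP => xE; move: xy0; rewrite xE mul0r ltxx.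
have yn0 : y != 0 by apply/eqP => yE; move: xy0; rewrite yE mulr0 ltxx.
have x_gt0 : 0 < x by rewrite lt_neqAle eq_sym xn0.
have y_gt0 : 0 < y by rewrite lt_neqAle eq_sym yn0.
pose c := d / (x * y); have dE : d = c * (x * y) by rewrite divfK ?gt_eqF.
have c1 : `|c| <= 1 by rewrite normrM normfV (gtr0_norm xy0) ler_pdivrMr// mul1r.
pose t := m / v; have t0 : 0 < t by rewrite divr_gt0.
pose s := t * x / y; have s0 : 0 < s by rewrite divr_gt0// mulr_gt0.
have mE : m = t * v by rewrite /t divfK// gt_eqF.
have xt : x * t = s * y by rewrite /s divfK// mulrC.
pose tau := t `^ (q - p); have tau0 : 0 < tau by rewrite powR_gt0.
pose P := y `^ p; have P0 : 0 < P by rewrite powR_gt0.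
have D (z a b : R) : 0 < z -> z `^ (a + b) = z `^ a * z `^ b.
  by move=> z0; rewrite powRD// (gt_eqF z0) implybT.
have pow1 (z : R) : 0 < z -> z `^ 1 = z by move=> z0; rewrite powRr1// ltW.
(* Every monomial becomes a power of t = m/v and of s, up to the common
   factor tau P. *)
have e1 : m `^ (q - 1) * v `^ (1 - q) = tau * t `^ (p - 1).
  rewrite mE powRM ?(ltW t0) ?(ltW v0)// -mulrA -D// -D//.
  by rewrite (_ : q - 1 + (1 - q) = 0) ?powRr0 ?mulr1; [congr powR|]; ring.
have e2 : m `^ q * v `^ (1 - q - 1) = tau * t `^ p.
  rewrite mE powRM ?(ltW t0) ?(ltW v0)// -mulrA -D// -D//.
  by rewrite (_ : q + (1 - q - 1) = 0) ?powRr0 ?mulr1; [congr powR|]; ring.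
have e3 : m `^ (q - p + 1 - 1) * v `^ (p - q) = tau.
  rewrite mE powRM ?(ltW t0) ?(ltW v0)// -mulrA -D//.
  by rewrite (_ : q - p + 1 - 1 + (p - q) = 0) ?powRr0 ?mulr1; [congr powR|]; ring.
have e4 : m `^ (q - p + 1) * v `^ (p - q - 1) = tau * t.
  rewrite mE powRM ?(ltW t0) ?(ltW v0)// -mulrA -D// D// pow1// -/tau.
  by rewrite (_ : q - p + 1 + (p - q - 1) = 0) ?powRr0 ?mulr1//; ring.
have f1 : x `^ (p - 2) * (x * y) * t `^ (p - 1) = s `^ (p - 1) * P.
  rewrite /P (_ : x `^ (p - 2) * (x * y) = x `^ (p - 1) * y); last first.
    rewrite mulrA -[X in _ * X * _](pow1 x)// -D//; congr (powR _ _ * _); ring.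
  rewrite mulrAC -powRM ?(ltW t0) ?(ltW x_gt0)// xt.
  rewrite powRM ?(ltW s0)// -mulrA -[X in _ * (_ * X)](pow1 y)// -D//.
  congr (_ * powR _ _); ring.
have f2 : x `^ (p - 2) * x ^+ 2 * t `^ p = s `^ p * P.
  rewrite /P (_ : x `^ (p - 2) * x ^+ 2 = x `^ p); last first.
    by rewrite -powR_mulrn// -D//; congr powR; rewrite subrK.
  by rewrite -powRM ?(ltW t0) ?(ltW x_gt0)// xt powRM ?(ltW s0).
have f3 : y `^ (p - 2) * y ^+ 2 = P.
  by rewrite -powR_mulrn// -D//; congr powR; rewrite subrK.
have f4 : y `^ (p - 2) * (x * y) * t = s * P.
  by rewrite -f3 -mulrA mulrAC xt; ring.
have -> : x `^ (p - 2) * (q * m `^ (q - 1) * al * v `^ (1 - q) * d +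
            m `^ q * ((1 - q) * v `^ (1 - q - 1) * be) * x ^+ 2) =
    tau * P * (q * al * s `^ (p - 1) * c + (1 - q) * be * s `^ p).
  rewrite dE.
  transitivity (q * al * c * (m `^ (q - 1) * v `^ (1 - q)) * (x `^ (p - 2) * (x * y)) +
     (1 - q) * be * (m `^ q * v `^ (1 - q - 1)) * (x `^ (p - 2) * x ^+ 2)); first by ring.
  rewrite e1 e2.
  transitivity (tau * (q * al * c * (x `^ (p - 2) * (x * y) * t `^ (p - 1))) +
     tau * ((1 - q) * be * (x `^ (p - 2) * x ^+ 2 * t `^ p))); first by ring.
  by rewrite f1 f2; ring.
have -> : y `^ (p - 2) * ((q - p + 1) * m `^ (q - p + 1 - 1) * al * v `^ (p - q) * y ^+ 2 +
            m `^ (q - p + 1) * ((p - q) * v `^ (p - q - 1) * be) * d) =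
    tau * P * ((q - p + 1) * al + (p - q) * be * s * c).
  rewrite dE.
  transitivity ((q - p + 1) * al * (m `^ (q - p + 1 - 1) * v `^ (p - q)) * (y `^ (p - 2) * y ^+ 2) +
     (p - q) * be * c * (m `^ (q - p + 1) * v `^ (p - q - 1)) * (y `^ (p - 2) * (x * y))); first by ring.
  rewrite e3 e4 f3.
  transitivity (tau * P * ((q - p + 1) * al) +
     tau * ((p - q) * be * c * (y `^ (p - 2) * (x * y) * t))); first by ring.
  by rewrite f4; ring.
rewrite -/P -subr_ge0.
have hc := picone_scalar s0 c1.
have T0 : 0 < s `^ (p - 1) by rewrite powR_gt0.
have S0 : 0 < s `^ p by rewrite powR_gt0.
have hCs := hC s s0.
move: (s `^ (p - 1)) (s `^ p) f1 hc T0 S0 hCs => T S f1 hc T0 S0 hCs.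
have /andP[c1l c1r] : -1 <= c <= 1 by rewrite -ler_norml.
case: mv => [[mv ab]|[vm ab]].
(* al >= be: the error term with x^(p-1) y absorbs the remainder. *)
- have t1 : t <= 1 by rewrite ler_pdivrMr// mul1r.
  have xyT : tau * (T * P) <= x `^ (p - 2) * (x * y).
    rewrite -f1 mulrCA ler_piMr// ?mulr_ge0 ?powR_ge0//.
    rewrite /tau -D// (_ : q - p + (p - 1) = q - 1); last by ring.
    rewrite -[leRHS](congr1 (@^~ (q - 1)) (@powR1 R)).
    by rewrite ge0_ler_powR ?nnegrE ?(ltW t0)//; lra.
  have k1 : 0 <= tau * P * (be * ((q - p + 1) + (p - q) * s * c - q * T * c + (q - 1) * S)).
    by rewrite !mulr_ge0// ltW.
  have k2 : 0 <= tau * P * ((al - be) * (q - p + 1)).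
    by rewrite !mulr_ge0 ?subr_ge0// ltW.
  have k3 : 0 <= C * (P * (1 - al)) by rewrite !mulr_ge0 ?subr_ge0// ltW.
  have k4 : q * (tau * (T * P) * (1 - be)) <= q * (x `^ (p - 2) * (x * y) * (1 - be)).
    by rewrite ler_pM2l// ler_wpM2r ?subr_ge0.
  have k5 : tau * P * ((al - be) * q * T * c) <= q * (tau * (T * P) * (1 - be)).
    rewrite (_ : q * _ = tau * P * (q * T * (1 - be))); last by ring.
    rewrite ler_wpM2l ?mulr_ge0 ?(ltW tau0) ?(ltW P0)//.
    rewrite (_ : (al - be) * q * T * c = q * T * ((al - be) * c)); last by ring.
    rewrite ler_wpM2l ?mulr_ge0 ?(ltW q0) ?(ltW T0)//.
    have : (al - be) * c <= al - be by rewrite ler_piMr// subr_ge0.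
    lra.
  move: k1 k2 k3 k4 k5; move: (x `^ (p - 2) * (x * y)) => W.
  move=> k1 k2 k3 k4 k5.
  rewrite (_ : _ - _ = tau * P * (be * ((q - p + 1) + (p - q) * s * c - q * T * c + (q - 1) * S))
   + tau * P * ((al - be) * (q - p + 1)) + C * (P * (1 - al))
   + (q * (W * (1 - be)) - tau * P * ((al - be) * q * T * c))); last by ring.
  apply: addr_ge0; last by rewrite subr_ge0 (le_trans k5).
  by apply: addr_ge0 => //; exact: addr_ge0.
(* al <= be: the error term with y^p absorbs the remainder. *)
- have t1 : 1 <= t by rewrite ler_pdivlMr// mul1r.
  have tau1 : tau <= 1.
    rewrite /tau -(opprB p q) powRN invf_le1 ?powR_gt0//.
    rewrite -[leLHS](congr1 (@^~ (p - q)) (@powR1 R)).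
    by rewrite ge0_ler_powR ?nnegrE ?(ltW t0).
  have k1 : 0 <= tau * P * (al * ((q - p + 1) + (p - q) * s * c - q * T * c + (q - 1) * S)).
    by rewrite !mulr_ge0// ltW.
  have k2 : - C <= (p - q) * s * c + (q - 1) * S.
    have : - ((p - q) * s) <= (p - q) * s * c.
      by rewrite -mulrN1 ler_wpM2l// mulr_ge0 // ltW.
    lra.
  have k3 : 0 <= tau * P * ((be - al) * ((p - q) * s * c + (q - 1) * S + C)).
    rewrite mulr_ge0 ?mulr_ge0 ?(ltW tau0) ?(ltW P0) ?subr_ge0//; lra.
  have k4 : tau * P * ((be - al) * C) <= C * (P * (1 - al)).
    rewrite (_ : C * _ = P * (1 * ((1 - al) * C))); last by ring.
    rewrite (_ : tau * P * _ = P * (tau * ((be - al) * C))); last by ring.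
    rewrite ler_wpM2l ?(ltW P0)// ler_pM ?(ltW tau0) ?mulr_ge0 ?subr_ge0//.
    by rewrite ler_wpM2r//; lra.
  have k5 : 0 <= q * (x `^ (p - 2) * (x * y) * (1 - be)).
    by rewrite !mulr_ge0 ?powR_ge0 ?subr_ge0// ltW.
  move: k1 k3 k4 k5; move: (x `^ (p - 2) * (x * y)) => W k1 k3 k4 k5.
  rewrite (_ : _ - _ = tau * P * (al * ((q - p + 1) + (p - q) * s * c - q * T * c + (q - 1) * S))
   + tau * P * ((be - al) * ((p - q) * s * c + (q - 1) * S + C))
   + (C * (P * (1 - al)) - tau * P * ((be - al) * C)) + q * (W * (1 - be))); last by ring.
  apply: addr_ge0 => //; apply: addr_ge0; last by rewrite subr_ge0.
  exact: addr_ge0.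
Qed.

End picone.

(** * Concavity of the truncation *)

(** Both cases of the hypotheses give (s / gs) gt <= s + t + 4. *)
Lemma quotient_bound {R : realType} (q s t gs gt : R) : 1 < q -> 0 < s -> 0 < t ->
  0 < gs -> 0 < gt -> gt <= t + 4 -> (t <= s -> gt <= gs) ->
  (s <= t -> gt * s <= gs * t) ->
  s `^ (q - 1) * (gt `^ q * gs `^ (1 - q)) <= (s + t + 4) `^ q.
Proof.
move=> q1 s0 t0 gs0 gt0 gtW order_ts star.
have W0 : 0 < s + t + 4 by rewrite !addr_gt0.
have q10 : 0 <= q - 1 by lra.
have h : s / gs * gt <= s + t + 4.
  rewrite mulrAC ler_pdivrMr// mulrC.
  have [ts|st] := leP t s.
    have h2 : gt * s <= gs * s by rewrite ler_wpM2r ?order_ts// ltW.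
    have h3 : gs * s <= gs * (s + t + 4) by rewrite ler_wpM2l ?(ltW gs0)//; lra.
    by rewrite (le_trans h2)// (le_trans h3)// mulrC.
  by rewrite (le_trans (star (ltW st)))// mulrC ler_wpM2r ?(ltW gs0)//; lra.
have -> : s `^ (q - 1) * (gt `^ q * gs `^ (1 - q)) = (s / gs * gt) `^ (q - 1) * gt.
  rewrite powRM ?divr_ge0 ?(ltW s0) ?(ltW gs0) ?(ltW gt0)//.
  rewrite powRM ?invr_ge0 ?(ltW s0) ?(ltW gs0)//.
  rewrite -[gs^-1]powR_inv1 ?(ltW gs0)// -powRrM mulN1r opprB.
  have -> : gt `^ q = gt `^ (q - 1) * gt.
    by rewrite -[X in _ = _ * X]powRr1 ?(ltW gt0)// -powRD ?(gt_eqF gt0) ?implybT// subrK.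
  by ring.
have -> : (s + t + 4) `^ q = (s + t + 4) `^ (q - 1) * (s + t + 4).
  by rewrite -[X in _ = _ * X]powRr1 ?(ltW W0)// -powRD ?(gt_eqF W0) ?implybT// subrK.
apply: ler_pM; rewrite ?powR_ge0 ?(ltW gt0)//; last by lra.
by rewrite ge0_ler_powR ?nnegrE ?(ltW W0)// mulr_ge0 ?divr_ge0 ?ltW.
Qed.

Section truncation_order.
Context {R : realType} (M : R).
Hypothesis M1 : 1 <= M.
Implicit Types s t : R.

Lemma trunc_MVT s t : s < t ->
  exists2 c, s < c < t & trunc M t - trunc M s = trunc' M c * (t - s).
Proof.
move=> st; have [||c] := @MVT R (trunc M) (trunc' M) s t st.
- by move=> x _; exact: is_derive_trunc.
- by apply: continuous_subspaceT; exact: trunc_continuous.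
- by rewrite in_itv/= => sct ->; exists c.
Qed.

Lemma trunc_ndecr s t : s <= t -> trunc M s <= trunc M t.
Proof.
rewrite le_eqVlt => /predU1P[->//|st]; have [c _ E] := trunc_MVT st.
by rewrite -subr_ge0 E mulr_ge0 ?trunc'_ge0// subr_ge0 ltW.
Qed.

(** For a concave function that is positive at 0, the slope of the line from the
    origin to the graph decreases. *)
Lemma trunc_chord_le s t : 0 < s -> s <= t -> trunc M t * s <= trunc M s * t.
Proof.
move=> s0; rewrite le_eqVlt => /predU1P[->//|st].
have [c /andP[sc ct] E] := trunc_MVT st.
have [b /andP[b0 bs] E0] := trunc_MVT s0.
have bc : trunc' M c <= trunc' M b by apply: (trunc'_nincr M1); [exact: ltW|exact: (ltW (lt_trans bs sc))].
have g0 := trunc_gt0 M1 0; rewrite subr0 in E0.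
move: (trunc' M c) (trunc' M b) (trunc M s) (trunc M t) (trunc M 0) E E0 bc g0.
move=> dc db gs gt g0 E E0 dcb g00.
have gsE : dc * s <= gs.
  have : dc * s <= db * s by rewrite ler_wpM2r// ltW.
  lra.
have -> : gt = gs + dc * (t - s) by lra.
have : dc * s * (t - s) <= gs * (t - s) by rewrite ler_wpM2r// subr_ge0 ltW.
lra.
Qed.

Lemma trunc_le_add4 s : 0 <= s -> trunc M s <= s + 4.
Proof.
move=> s0; rewrite (le_trans (trunc_le M1 s0))// lerD2l ler_pdivrMr ?ler_peMr//.
by rewrite (lt_le_trans ltr01).
Qed.

(** This dominates the quotient that the negative power of [trunc M s] creates,
    uniformly in [M]. *)
Lemma trunc_quotient_le (q s t : R) : 1 < q -> 0 < s -> 0 < t ->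
  s `^ (q - 1) * (trunc M t `^ q * trunc M s `^ (1 - q)) <= (s + t + 4) `^ q.
Proof.
move=> q1 s0 t0.
exact: (quotient_bound q1 s0 t0 (trunc_gt0 M1 s) (trunc_gt0 M1 t)
  (trunc_le_add4 (ltW t0)) (@trunc_ndecr t s) (trunc_chord_le s0)).
Qed.

End truncation_order.

Lemma cvg_powR_gt0 {R : realType} (a_ : nat -> R) (l r : R) : 0 < l ->
  a_ n @[n --> \oo] --> l -> a_ n `^ r @[n --> \oo] --> l `^ r.
Proof.
move=> l0 al; have [/derivable1_diffP/differentiable_continuous c _] := is_derive1_powR r l0.
exact: (continuous_cvg _ c al).
Qed.

Lemma cvg_powR_0 {R : realType} (a_ : nat -> R) (r : R) : 0 < r ->
  (forall n, 0 <= a_ n) ->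
  a_ n @[n --> \oo] --> (0 : R) -> a_ n `^ r @[n --> \oo] --> (0 : R).
Proof.
move=> r0 a0 al; apply/cvgrPdist_lt => e e0.
have er : 0 < e `^ r^-1 by rewrite powR_gt0.
near=> n; have an : a_ n < e `^ r^-1 by near: n; exact: (cvgr_lt _ al _ er).
rewrite sub0r normrN ger0_norm ?powR_ge0//.
have -> : e = (e `^ r^-1) `^ r by rewrite -powRrM mulVf ?gt_eqF// powRr1// ltW.
by rewrite gt0_ltr_powR// ?nnegrE ?powR_ge0.
Unshelve. all: by end_near. Qed.

Lemma powR_le_powR_ge1 {R : realType} (W r p : R) : 1 <= W -> r <= p ->
  W `^ r <= W `^ p.
Proof. by move=> W1 rp; rewrite ler_powR. Qed.

Lemma abs_powR_mul {R : realType} (s r : R) : 1 < r -> 0 <= s ->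
  `|s| `^ (r - 2) * s = s `^ (r - 1).
Proof.
move=> r1 s0; rewrite ger0_norm//; have [->|sn0] := eqVneq s 0.
  by rewrite mulr0 powR0// gt_eqF// subr_gt0.
rewrite -[X in _ * X]powRr1// -powRD ?sn0 ?implybT//; congr powR; ring.
Qed.

(** * The integrated Picone inequality *)

(** [W] stands for u + phi + 4, [Z] for the truncated test function and [c] for
    the constant subtracted from it; the bound does not depend on the level of
    the truncation. *)
Lemma picone_source_bound {R : realType} (p q lam a Ba s W Z c : R) :
  1 < q -> q < p -> 0 <= s -> s <= W -> 1 <= W -> `|a| <= Ba ->
  0 <= Z -> 0 <= c <= 4 -> (0 < s -> s `^ (q - 1) * Z <= W `^ q) ->
  `|(lam * s `^ (p - 1) + a * s `^ (q - 1)) * (Z - c)| <= 5 * (`|lam| + Ba) * W `^ p.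
Proof.
move=> q1 qp s0 sW W1 aB Z0 /andP[c0 c4] hZ.
have q10 : 0 < q - 1 by lra.
have pq0 : 0 <= p - q by lra.
have p10 : 0 < p - 1 by lra.
have W0 : 0 < W by lra.
have hq : s `^ (q - 1) * Z <= W `^ q.
  have [s0'|] := ltP 0 s; first exact: hZ.
  move=> s_le0; have -> : s = 0 by apply/eqP; rewrite eq_le s_le0.
  by rewrite powR0 ?gt_eqF// mul0r powR_ge0.
have WD r r' : W `^ (r + r') = W `^ r * W `^ r' by rewrite powRD// (gt_eqF W0) implybT.
have Wle r : r <= p -> W `^ r <= W `^ p by exact: powR_le_powR_ge1.
have spq : s `^ (p - 1) = s `^ (p - q) * s `^ (q - 1).
  have [->|sn0] := eqVneq s 0; first by rewrite (powR0 (lt0r_neq0 p10)) (powR0 (lt0r_neq0 q10)) mulr0.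
  by rewrite -powRD ?sn0 ?implybT//; congr powR; ring.
have mono r : 0 <= r -> s `^ r <= W `^ r.
  by move=> r0; rewrite ge0_ler_powR ?nnegrE ?(ltW W0).
(* The factor 5 is 1 for the part with Z and 4 for the constant. *)
have A1 : s `^ (q - 1) * (Z + 4) <= 5 * W `^ p.
  have h1 : W `^ q <= W `^ p by apply: Wle; exact: ltW.
  have h2 : s `^ (q - 1) <= W `^ p.
    by apply: (le_trans (mono _ (ltW q10))); apply: Wle; lra.
  rewrite mulrDr; lra.
have A2 : s `^ (p - 1) * (Z + 4) <= 5 * W `^ p.
  have h1 : s `^ (p - 1) * Z <= W `^ p.
    rewrite spq -mulrA (_ : W `^ p = W `^ (p - q) * W `^ q); last by rewrite -WD subrK.
    by apply: ler_pM => //; rewrite ?mulr_ge0 ?powR_ge0// mono.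
  have h2 : s `^ (p - 1) <= W `^ p.
    by apply: (le_trans (mono _ (ltW p10))); apply: Wle; lra.
  rewrite mulrDr; lra.
have Zc : `|Z - c| <= Z + 4 by rewrite ler_norml; apply/andP; split; lra.
have Z4 : 0 <= Z + 4 by lra.
have Ba0 : 0 <= Ba by rewrite (le_trans _ aB).
have k0 : `|lam * s `^ (p - 1) + a * s `^ (q - 1)| <=
    `|lam| * s `^ (p - 1) + Ba * s `^ (q - 1).
  rewrite (le_trans (ler_normD _ _))// !normrM !(ger0_norm (powR_ge0 _ _)).
  by rewrite lerD2l ler_wpM2r// powR_ge0.
have k1 := ler_wpM2l (normr_ge0 lam) A2; have k2 := ler_wpM2l Ba0 A1.
rewrite normrM.
apply: (le_trans (ler_pM (normr_ge0 _) (normr_ge0 _) k0 Zc)).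
rewrite (_ : 5 * _ * _ = `|lam| * (5 * W `^ p) + Ba * (5 * W `^ p)); last by ring.
by rewrite mulrDl -!mulrA; exact: lerD.
Qed.

Lemma picone_eigen_bound {R : realType} (p q lam t W m v c : R) :
  1 < q -> q < p -> 0 <= q - p + 1 -> 0 <= t -> t <= W -> 1 <= W ->
  0 <= m <= W -> 0 <= v <= W -> 0 <= c <= 4 ->
  `|(lam * t `^ (p - 1)) * (m `^ (q - p + 1) * v `^ (p - q) - c)| <= 5 * `|lam| * W `^ p.
Proof.
move=> q1 qp gap t0 tW W1 /andP[m0 mW] /andP[v0 vW] /andP[c0 c4].
have W0 : 0 < W by lra.
have pq0 : 0 <= p - q by lra.
have p10 : 0 <= p - 1 by lra.
have WD r r' : W `^ (r + r') = W `^ r * W `^ r' by rewrite powRD// (gt_eqF W0) implybT.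
have mono z r : 0 <= z -> z <= W -> 0 <= r -> z `^ r <= W `^ r.
  by move=> z0 zW r0; rewrite ge0_ler_powR ?nnegrE ?(ltW W0).
have Z0 : 0 <= m `^ (q - p + 1) * v `^ (p - q) by rewrite mulr_ge0 ?powR_ge0.
have ZW : m `^ (q - p + 1) * v `^ (p - q) <= W.
  have -> : W = W `^ (q - p + 1) * W `^ (p - q).
    by rewrite -WD (_ : q - p + 1 + (p - q) = 1) ?powRr1 ?(ltW W0)//; ring.
  by apply: ler_pM; rewrite ?powR_ge0// mono.
move: (m `^ _ * _) Z0 ZW => Z Z0 ZW.
have Zc : `|Z - c| <= 5 * W by rewrite ler_norml; apply/andP; split; lra.
rewrite !normrM (ger0_norm (powR_ge0 _ _)).
rewrite (_ : 5 * _ * _ = `|lam| * W `^ (p - 1) * (5 * W)); last first.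
  have -> : W `^ p = W `^ (p - 1) * W.
    by rewrite -[X in _ = _ * X](powRr1 (ltW W0)) -WD subrK.
  ring.
by apply: ler_pM; rewrite ?mulr_ge0 ?powR_ge0 ?ler_wpM2l ?mono.
Qed.

Lemma powR_split1 {R : realType} (x r r' : R) : 0 < x -> r + r' = 1 ->
  x `^ r * x `^ r' = x.
Proof. by move=> x0 rr; rewrite -powRD ?(gt_eqF x0) ?implybT// rr powRr1// ltW. Qed.

Section integrated_picone.
Context {R : realType} {N : nat} (Omega : set 'rV[R]_N) (p q : R).
Local Notation mu := (lebesgue_rV N).
Hypotheses (oOmega : open Omega) (fin_Omega : (mu Omega < +oo)%E).
Hypotheses (q_gt1 : 1 < q) (q_lt_p : q < p).
Hypothesis pq_cond : forall s : R, 0 <= s ->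
  0 <= (q - 1) * s `^ p + q * s `^ (p - 1) - (p - q) * s + (q - p + 1).
Variables (phi u fphi fu : 'rV[R]_N -> R) (Gphi Gu : 'rV[R]_N -> 'rV[R]_N).
Hypotheses (Wphi : W01p Omega p phi Gphi) (Wu : W01p Omega p u Gu).
Hypotheses (phi_gt0 : forall x, Omega x -> 0 < phi x).
Hypotheses (u_ge0 : forall x, Omega x -> 0 <= u x).
Hypotheses (ifphi : mu.-integrable Omega (EFin \o fphi)).
Hypotheses (ifu : mu.-integrable Omega (EFin \o fu)).
Hypothesis eq_phi : forall w, test_function Omega w ->
  plaplace_form Omega p Gphi (grad w) = \int[mu]_(x in Omega) (fphi x * w x).
Hypothesis eq_u : forall w, test_function Omega w ->
  plaplace_form Omega p Gu (grad w) = \int[mu]_(x in Omega) (fu x * w x).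

Let mOmega : measurable Omega := open_rV_measurable oOmega.
Let p_gt1 : 1 < p. Proof. exact: lt_trans q_gt1 q_lt_p. Qed.
Let p_gt0 : 0 < p. Proof. exact: lt_trans ltr01 p_gt1. Qed.

Definition picone_lhs M x := fu x * (trunc M (phi x) `^ q * trunc M (u x) `^ (1 - q)
   - trunc M 0 `^ q * trunc M 0 `^ (1 - q)).

Definition picone_rhs M x := fphi x * (trunc M (phi x) `^ (q - p + 1) * trunc M (u x) `^ (p - q)
   - trunc M 0 `^ (q - p + 1) * trunc M 0 `^ (p - q)).

(** The error term of [picone_pointwise] at a point of Omega. *)
Definition picone_err C M x :=
  C * (enorm (Gphi x) `^ p * (1 - trunc' M (phi x))) +
  q * (enorm (Gu x) `^ (p - 2) * (enorm (Gu x) * enorm (Gphi x)) * (1 - trunc' M (u x))).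

Lemma picone_err_bound C M x : 0 <= C -> 1 <= M ->
  0 <= picone_err C M x <=
    C * enorm (Gphi x) `^ p + q * (enorm (Gu x) `^ p + enorm (Gphi x) `^ p).
Proof.
move=> C0 M1; have q0 : 0 < q by exact: lt_trans ltr01 q_gt1.
have gen al be : 0 <= al <= 1 -> 0 <= be <= 1 ->
    0 <= C * (enorm (Gphi x) `^ p * al) +
         q * (enorm (Gu x) `^ (p - 2) * (enorm (Gu x) * enorm (Gphi x)) * be) <=
    C * enorm (Gphi x) `^ p + q * (enorm (Gu x) `^ p + enorm (Gphi x) `^ p).
  move=> /andP[a0 a1] /andP[b0 b1]; apply/andP; split.
    by rewrite addr_ge0// ?mulr_ge0 ?powR_ge0 ?enorm_ge0// ltW.
  apply: lerD; first by rewrite ler_wpM2l// ler_piMr// powR_ge0.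
  rewrite ler_pM2l// (le_trans (ler_piMr _ b1))//.
    by rewrite !mulr_ge0 ?powR_ge0 ?enorm_ge0.
  by rewrite powR_young ?enorm_ge0.
have e (t : R) : 0 <= 1 - trunc' M t <= 1.
  by rewrite subr_ge0 (trunc'_le1 M1)//= gerBl (trunc'_ge0 M1).
exact: gen (e _) (e _).
Qed.

Lemma measurable_picone_err C M : 1 <= M -> measurable_fun Omega (picone_err C M).
Proof.
move=> M1.
have [mphi _ mGphi _] := W01p_measurable_integrable mOmega p_gt0 Wphi.
have [mu' _ mGu _] := W01p_measurable_integrable mOmega p_gt0 Wu.
have mt (f : 'rV[R]_N -> R) : measurable_fun Omega f ->
    measurable_fun Omega (fun x => 1 - trunc' M (f x)).
  move=> mf; apply: measurable_funB => //.
  apply: (@measurableT_comp _ _ _ _ _ _ (trunc' M)) => //.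
  by apply: continuous_measurable_fun; exact: trunc'_continuous.
have mE := measurable_enorm mGphi; have mE' := measurable_enorm mGu.
have mp r (G : 'rV[R]_N -> 'rV[R]_N) : measurable_fun Omega (fun x => enorm (G x)) ->
    measurable_fun Omega (fun x => enorm (G x) `^ r).
  by move=> mG; exact: (@measurableT_comp _ _ _ _ _ _ (fun x => x `^ r)).
apply: measurable_funD; apply: measurable_funM => //; apply: measurable_funM.
- exact: mp.
- exact: mt.
- by apply: measurable_funM; [exact: mp|exact: measurable_funM].
- exact: mt.
Qed.

Lemma integrable_picone_err_bound C : mu.-integrable Omega (EFin \o (fun x =>
    C * enorm (Gphi x) `^ p + q * (enorm (Gu x) `^ p + enorm (Gphi x) `^ p))).
Proof.
have [_ _ _ iGphi] := W01p_measurable_integrable mOmega p_gt0 Wphi.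
have [_ _ _ iGu] := W01p_measurable_integrable mOmega p_gt0 Wu.
rewrite (_ : _ \o _ = (fun x => C%:E * (enorm (Gphi x) `^ p)%:E +
  q%:E * ((enorm (Gu x) `^ p)%:E + (enorm (Gphi x) `^ p)%:E))%E)//.
by apply: integrableD => //; apply: integrableZl => //; apply: integrableD.
Qed.

(** The slopes of the truncation tend to 1 at every nonnegative number, also
    where [u] vanishes. *)
Lemma cvg_picone_err C : 0 <= C ->
  \int[mu]_(x in Omega) picone_err C n.+1%:R x @[n --> \oo] --> (0 : R).
Proof.
move=> C0; have M1 n := @trunc_level_ge1 R n.
have pt : {ae mu, forall x, Omega x -> picone_err C n.+1%:R x @[n --> \oo] --> (0 : R)}.
  apply: aeW => x Ox.
  have c1 := cvg_trunc' (ltW (phi_gt0 Ox)); have c2 := cvg_trunc' (u_ge0 Ox).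
  have k (K : R) (b : nat -> R) : b n @[n --> \oo] --> (1 : R) ->
      K * (1 - b n) @[n --> \oo] --> (0 : R).
    move=> cb; rewrite -[X in _ --> X](mulr0 K) -[X in K * X](subrr 1).
    by apply: cvgM; [exact: cvg_cst|apply: cvgB; [exact: cvg_cst|exact: cb]].
  rewrite -[X in _ --> X](addr0 0) -[X in _ --> X + _](mulr0 C) -[X in _ --> _ + X](mulr0 q).
  apply: cvgD; (apply: cvgM; first exact: cvg_cst).
    exact: (k _ (fun n => trunc' n.+1%:R (phi x)) c1).
  exact: (k _ (fun n => trunc' n.+1%:R (u x)) c2).
have dom : {ae mu, forall x, Omega x -> forall n, `|picone_err C n.+1%:R x| <=
    C * enorm (Gphi x) `^ p + q * (enorm (Gu x) `^ p + enorm (Gphi x) `^ p)}.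
  apply: aeW => x _ n.
  by have /andP[e0 e1] := picone_err_bound x C0 (M1 n); rewrite ger0_norm.
have [_] := Rintegral_dominated mOmega (fun n => measurable_picone_err C (M1 n))
   (measurable_cst (0 : R)) pt (integrable_picone_err_bound C) dom.
by rewrite Rintegral_cst// mul0r.
Qed.

(** By the tested equations, the integrals of the two sides of the pointwise
    inequality are those of [picone_lhs] and [picone_rhs]. *)
Lemma integrated_picone : exists2 C : R, 0 <= C & forall M, 1 <= M ->
  [/\ mu.-integrable Omega (EFin \o picone_lhs M),
      mu.-integrable Omega (EFin \o picone_rhs M) &
      \int[mu]_(x in Omega) picone_lhs M x <=
      \int[mu]_(x in Omega) picone_rhs M x +
      \int[mu]_(x in Omega) picone_err C M x].
Proof.
have [C C0 hC] := picone_pointwise q_gt1 q_lt_p pq_cond.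
exists C => // M M1.
have [_ _ mGphi iGphi] := W01p_measurable_integrable mOmega p_gt0 Wphi.
have [_ _ mGu iGu] := W01p_measurable_integrable mOmega p_gt0 Wu.
have sb := smooth_bounded_trunc M1.
have [iX1 iY1 E1] := limit_test_equation oOmega p_gt1 (sb q) (sb (1 - q))
  Wphi Wu mGu iGu ifu eq_u.
have [iX2 iY2 E2] := limit_test_equation oOmega p_gt1 (sb (q - p + 1)) (sb (p - q))
  Wphi Wu mGphi iGphi ifphi eq_phi.
have iErr : mu.-integrable Omega (EFin \o picone_err C M).
  apply: (integrable_dominated mOmega (measurable_picone_err C M1)
    (integrable_picone_err_bound C)) => x _.
  by have /andP[e0 e1] := picone_err_bound x C0 M1; rewrite ger0_norm.
split => //.
rewrite /picone_lhs /picone_rhs -E1 -E2 -RintegralD//.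
apply: le_Rintegral => //.
  exact: (integrableD mOmega iX2 iErr).
move=> x Ox /=; rewrite !dotvDr !dotvZr -!sqr_enorm (dotvC (Gphi x) (Gu x)).
have t01 s : 0 <= trunc' M s <= 1 by rewrite (trunc'_ge0 M1) (trunc'_le1 M1).
apply: (hC (enorm (Gu x)) (enorm (Gphi x)) (dotv (Gu x) (Gphi x))
  (trunc M (phi x)) (trunc M (u x)) (trunc' M (phi x)) (trunc' M (u x))
  (enorm_ge0 _) (enorm_ge0 _) (dotv_CauchySchwarz _ _) (trunc_gt0 M1 _) (trunc_gt0 M1 _)
  (t01 _) (t01 _)).
have [pu|up] := leP (phi x) (u x); [left|right]; split.
- exact: trunc_ndecr.
- by apply: trunc'_nincr => //; exact/ltW/phi_gt0.
- exact/trunc_ndecr/ltW.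
- by apply: trunc'_nincr => //; [exact: u_ge0|exact: ltW].
Qed.

End integrated_picone.

(** * Removing the truncation *)

(** Replace each term by the largest one. *)
Lemma powR_sum3_le {R : realType} (a b c p : R) : 0 <= a -> 0 <= b -> 0 <= c -> 0 < p ->
  (a + b + c) `^ p <= 3 `^ p * (a `^ p + b `^ p + c `^ p).
Proof.
move=> a0 b0 c0 p0.
have [z z0 [zs za]] : exists2 z : R, 0 <= z &
    a + b + c <= 3 * z /\ z `^ p <= a `^ p + b `^ p + c `^ p.
  have [A B C] : [/\ 0 <= a `^ p, 0 <= b `^ p & 0 <= c `^ p] by rewrite !powR_ge0.
  have [ab|ba] := leP a b; have [bc|cb] := leP b c; have [ac|ca] := leP a c;
    (exists c => //; split; lra) || (exists b => //; split; lra) || (exists a => //; split; lra).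
apply: (@le_trans _ _ ((3 * z) `^ p)).
  by rewrite ge0_ler_powR ?nnegrE ?addr_ge0 ?mulr_ge0// ltW.
by rewrite powRM// ler_wpM2l// powR_ge0.
Qed.

Section limit_picone.
Context {R : realType} {N : nat} (Omega : set 'rV[R]_N) (p q : R).
Local Notation mu := (lebesgue_rV N).
Hypotheses (oOmega : open Omega) (fin_Omega : (mu Omega < +oo)%E).
Hypotheses (q_gt1 : 1 < q) (q_lt_p : q < p).
Hypothesis pq_cond : forall s : R, 0 <= s ->
  0 <= (q - 1) * s `^ p + q * s `^ (p - 1) - (p - q) * s + (q - p + 1).
Variables (a phi u : 'rV[R]_N -> R) (Gphi Gu : 'rV[R]_N -> 'rV[R]_N) (lam lam1 Ba : R).
Hypotheses (Wphi : W01p Omega p phi Gphi) (Wu : W01p Omega p u Gu).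
Hypotheses (phi_gt0 : forall x, Omega x -> 0 < phi x).
Hypotheses (u_ge0 : forall x, Omega x -> 0 <= u x).
Hypotheses (ma : measurable_fun Omega a) (aB : forall x, Omega x -> `|a x| <= Ba).

Let mOmega : measurable Omega := open_rV_measurable oOmega.
Let p_gt1 : 1 < p. Proof. exact: lt_trans q_gt1 q_lt_p. Qed.
Let p_gt0 : 0 < p. Proof. exact: lt_trans ltr01 p_gt1. Qed.

(** The right-hand side of the equation of [u], written for u >= 0. *)
Definition source_u x := lam * u x `^ (p - 1) + a x * u x `^ (q - 1).
Definition source_phi x := lam1 * phi x `^ (p - 1).
Definition envelope x := u x + phi x + 4.

Let mphi : measurable_fun Omega phi.
Proof. by have [] := W01p_measurable_integrable mOmega p_gt0 Wphi. Qed.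
Let mu_ : measurable_fun Omega u.
Proof. by have [] := W01p_measurable_integrable mOmega p_gt0 Wu. Qed.

Let mpow (f : 'rV[R]_N -> R) (r : R) : measurable_fun Omega f ->
  measurable_fun Omega (fun x => f x `^ r).
Proof. by move=> mf; exact: (@measurableT_comp _ _ _ _ _ _ (fun x => x `^ r)). Qed.

Lemma envelope_ge x : Omega x ->
  [/\ 1 <= envelope x, 0 < envelope x, u x <= envelope x & phi x <= envelope x].
Proof. by move=> Ox; have := u_ge0 Ox; have := phi_gt0 Ox; rewrite /envelope; split; lra. Qed.

Lemma integrable_envelope : mu.-integrable Omega (EFin \o (fun x => envelope x `^ p)).
Proof.
have [_ iphi _ _] := W01p_measurable_integrable mOmega p_gt0 Wphi.
have [_ iu _ _] := W01p_measurable_integrable mOmega p_gt0 Wu.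
apply: (integrable_dominated mOmega (g := fun x =>
   3 `^ p * (`|u x| `^ p + `|phi x| `^ p + 4 `^ p))).
- by apply: mpow; apply: measurable_funD => //; exact: measurable_funD.
- have i4 : mu.-integrable Omega (fun=> (4 `^ p)%:E).
    exact: (@measurable_bounded_integrable _ _ _ mu (cst (4 `^ p)) Omega mOmega
      fin_Omega (measurable_cst _) (bounded_cst _ _)).
  exact: (integrableZl mOmega (3 `^ p) (integrableD mOmega (integrableD mOmega iu iphi) i4)).
- move=> x Ox; rewrite (ger0_norm (powR_ge0 _ _)).
  rewrite (ger0_norm (u_ge0 Ox)) (ger0_norm (ltW (phi_gt0 Ox))).
  by apply: powR_sum3_le => //; [exact: u_ge0|exact/ltW/phi_gt0].
Qed.

Lemma integrable_envelopeZ (K : R) :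
  mu.-integrable Omega (EFin \o (fun x => K * envelope x `^ p)).
Proof. exact: (integrableZl mOmega K integrable_envelope). Qed.

Let Wpow x (f : 'rV[R]_N -> R) (r : R) : Omega x -> 0 <= f x -> f x <= envelope x ->
  0 <= r -> r <= p -> f x `^ r <= envelope x `^ p.
Proof.
move=> Ox f0 fW r0 rp; have [W1 W0 _ _] := envelope_ge Ox.
apply: (@le_trans _ _ (envelope x `^ r)).
  by rewrite ge0_ler_powR ?nnegrE// ltW.
exact: powR_le_powR_ge1.
Qed.

Let upow x r : Omega x -> 0 <= r -> r <= p -> u x `^ r <= envelope x `^ p.
Proof.
by move=> Ox; apply: Wpow => //; [exact: u_ge0|have [] := envelope_ge Ox].
Qed.

Let phipow x r : Omega x -> 0 <= r -> r <= p -> phi x `^ r <= envelope x `^ p.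
Proof.
by move=> Ox; apply: Wpow => //; [exact/ltW/phi_gt0|have [] := envelope_ge Ox].
Qed.

Lemma integrable_u_pow (b : 'rV[R]_N -> R) (B r : R) : measurable_fun Omega b ->
  (forall x, Omega x -> `|b x| <= B) -> 0 <= r -> r <= p ->
  mu.-integrable Omega (EFin \o (fun x => b x * u x `^ r)).
Proof.
move=> mb bB r0 rp; apply: (integrable_dominated mOmega _ (integrable_envelopeZ B)).
  by apply: measurable_funM => //; exact: mpow.
move=> x Ox; rewrite normrM (ger0_norm (powR_ge0 _ _)).
by apply: ler_pM; rewrite ?powR_ge0 ?bB ?upow.
Qed.

Lemma integrable_phi_pow (b : 'rV[R]_N -> R) (B r : R) : measurable_fun Omega b ->
  (forall x, Omega x -> `|b x| <= B) -> 0 <= r -> r <= p ->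
  mu.-integrable Omega (EFin \o (fun x => b x * phi x `^ r)).
Proof.
move=> mb bB r0 rp; apply: (integrable_dominated mOmega _ (integrable_envelopeZ B)).
  by apply: measurable_funM => //; exact: mpow.
move=> x Ox; rewrite normrM (ger0_norm (powR_ge0 _ _)).
by apply: ler_pM; rewrite ?powR_ge0 ?bB ?phipow.
Qed.

Let r1 : 0 <= p - 1. Proof. by rewrite subr_ge0 ltW. Qed.
Let r2 : p - 1 <= p. Proof. by rewrite gerBl. Qed.
Let r3 : 0 <= q - 1. Proof. by rewrite subr_ge0 ltW. Qed.
Let r4 : q - 1 <= p. Proof. by rewrite (le_trans _ (ltW q_lt_p))// gerBl. Qed.

Lemma integrable_source_u : mu.-integrable Omega (EFin \o source_u).
Proof.
exact: (integrableD mOmega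
  (@integrable_u_pow (cst lam) `|lam| _ (measurable_cst _) (fun _ _ => lexx _) r1 r2)
  (integrable_u_pow ma aB r3 r4)).
Qed.

Lemma integrable_source_phi : mu.-integrable Omega (EFin \o source_phi).
Proof.
exact: (@integrable_phi_pow (cst lam1) `|lam1| _ (measurable_cst _) (fun _ _ => lexx _) r1 r2).
Qed.

Hypothesis eq_phi : forall w, test_function Omega w ->
  plaplace_form Omega p Gphi (grad w) = \int[mu]_(x in Omega) (source_phi x * w x).
Hypothesis eq_u : forall w, test_function Omega w ->
  plaplace_form Omega p Gu (grad w) = \int[mu]_(x in Omega) (source_u x * w x).

Definition limit_lhs x := source_u x * (phi x `^ q * u x `^ (1 - q)).
Definition limit_rhs x := source_phi x * (phi x `^ (q - p + 1) * u x `^ (p - q)).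

Let M1 n : 1 <= n.+1%:R :> R. Proof. exact: trunc_level_ge1. Qed.

Let c04 n (r r' : R) : r + r' = 1 ->
  0 <= trunc n.+1%:R 0 `^ r * trunc n.+1%:R 0 `^ r' <= 4.
Proof.
move=> rr; rewrite (powR_split1 (trunc_gt0 (M1 n) 0) rr) (ltW (trunc_gt0 (M1 n) 0)) /=.
by have := trunc_le_add4 (M1 n) (lexx 0); rewrite add0r.
Qed.

Let cvgc (r r' : R) : r + r' = 1 ->
  trunc n.+1%:R 0 `^ r * trunc n.+1%:R 0 `^ r' @[n --> \oo] --> (0 : R).
Proof.
move=> rr; under eq_fun => n do rewrite (powR_split1 (trunc_gt0 (M1 n) 0) rr).
exact: cvg_trunc.
Qed.

(** Where [u] vanishes, so does [source_u], and the values of the negative power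
    of the truncation do not matter. *)
Lemma cvg_picone_lhs : mu.-integrable Omega (EFin \o limit_lhs) /\
  \int[mu]_(x in Omega) picone_lhs q phi u source_u n.+1%:R x @[n --> \oo] -->
  \int[mu]_(x in Omega) limit_lhs x.
Proof.
have qq : q + (1 - q) = 1 by rewrite addrC subrK.
have msrc : measurable_fun Omega source_u.
  by have /integrableP[/measurable_EFinP] := integrable_source_u.
have mtr n (f : 'rV[R]_N -> R) : measurable_fun Omega f ->
    measurable_fun Omega (fun x => trunc n.+1%:R (f x)).
  move=> mf; apply: (@measurableT_comp _ _ _ _ _ _ (trunc n.+1%:R)) => //.
  by apply: continuous_measurable_fun; exact: trunc_continuous.
apply: (Rintegral_dominated mOmega (g := fun x => 5 * (`|lam| + Ba) * envelope x `^ p)).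
- move=> n; apply: measurable_funM => //; apply: measurable_funB => //.
  by apply: measurable_funM; apply: mpow; exact: mtr.
- by apply: measurable_funM => //; apply: measurable_funM; exact: mpow.
- apply: aeW => x Ox; rewrite /picone_lhs /limit_lhs.
  have [ux0|ux0] := eqVneq (u x) 0.
    have s0 : source_u x = 0.
      rewrite /source_u ux0 !powR0 ?mulr0 ?addr0// gt_eqF// subr_gt0//.
    rewrite s0 mul0r; under eq_fun do rewrite mul0r.
    exact: cvg_cst.
  have ux : 0 < u x by rewrite lt_neqAle eq_sym ux0 u_ge0.
  apply: cvgM; first exact: cvg_cst.
  rewrite -[X in _ --> X]subr0; apply: cvgB; last exact: cvgc.
  apply: cvgM.
    exact: (cvg_powR_gt0 (phi_gt0 Ox) (cvg_trunc (ltW (phi_gt0 Ox)))).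
  exact: (cvg_powR_gt0 ux (cvg_trunc (u_ge0 Ox))).
- exact: integrable_envelopeZ.
- apply: aeW => x Ox n; have [W1 W0 uW _] := envelope_ge Ox.
  apply: picone_source_bound => //; [exact: u_ge0|exact: aB| |exact: c04|].
    by rewrite mulr_ge0 ?powR_ge0.
  by move=> ux; apply: trunc_quotient_le => //; exact: phi_gt0.
Qed.

(** The exponent p - q of the truncation of [u] is positive, so there is no
    singularity where [u] vanishes. *)
Lemma cvg_picone_rhs : mu.-integrable Omega (EFin \o limit_rhs) /\
  \int[mu]_(x in Omega) picone_rhs p q phi u source_phi n.+1%:R x @[n --> \oo] -->
  \int[mu]_(x in Omega) limit_rhs x.
Proof.
have qq : q - p + 1 + (p - q) = 1 by rewrite addrAC subrKA subrr add0r.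
have msrc : measurable_fun Omega source_phi.
  by have /integrableP[/measurable_EFinP] := integrable_source_phi.
have mtr n (f : 'rV[R]_N -> R) : measurable_fun Omega f ->
    measurable_fun Omega (fun x => trunc n.+1%:R (f x)).
  move=> mf; apply: (@measurableT_comp _ _ _ _ _ _ (trunc n.+1%:R)) => //.
  by apply: continuous_measurable_fun; exact: trunc_continuous.
apply: (Rintegral_dominated mOmega (g := fun x => 5 * `|lam1| * envelope x `^ p)).
- move=> n; apply: measurable_funM => //; apply: measurable_funB => //.
  by apply: measurable_funM; apply: mpow; exact: mtr.
- by apply: measurable_funM => //; apply: measurable_funM; exact: mpow.
- apply: aeW => x Ox; rewrite /picone_rhs /limit_rhs.
  apply: cvgM; first exact: cvg_cst.
  rewrite -[X in _ --> X]subr0; apply: cvgB; last exact: cvgc.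
  apply: cvgM.
    exact: (cvg_powR_gt0 (phi_gt0 Ox) (cvg_trunc (ltW (phi_gt0 Ox)))).
  have [ux0|ux0] := eqVneq (u x) 0.
    rewrite ux0 powR0 ?gt_eqF ?subr_gt0//.
    apply: cvg_powR_0; [by rewrite subr_gt0|by move=> n; exact/ltW/trunc_gt0|exact: cvg_trunc].
  have ux : 0 < u x by rewrite lt_neqAle eq_sym ux0 u_ge0.
  exact: (cvg_powR_gt0 ux (cvg_trunc (u_ge0 Ox))).
- exact: integrable_envelopeZ.
- apply: aeW => x Ox n; have [W1 W0 _ phiW] := envelope_ge Ox.
  have phi0 := ltW (phi_gt0 Ox); have u0 := u_ge0 Ox.
  apply: picone_eigen_bound => //.
  + exact: pq_gap pq_cond.
  + rewrite (ltW (trunc_gt0 (M1 n) _)) /= (le_trans (trunc_le_add4 (M1 n) phi0))//.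
    by rewrite /envelope lerD2r lerDr.
  + rewrite (ltW (trunc_gt0 (M1 n) _)) /= (le_trans (trunc_le_add4 (M1 n) u0))//.
    by rewrite /envelope lerD2r lerDl.
  + exact: c04.
Qed.

(** The limit of [integrated_picone] as the level of the truncation tends to
    infinity. *)
Lemma limit_picone :
  \int[mu]_(x in Omega) limit_lhs x <= \int[mu]_(x in Omega) limit_rhs x.
Proof.
have [C C0 hC] := integrated_picone oOmega q_gt1 q_lt_p pq_cond Wphi Wu
  phi_gt0 u_ge0 integrable_source_phi integrable_source_u eq_phi eq_u.
have [_ cl] := cvg_picone_lhs; have [_ cr] := cvg_picone_rhs.
have ce := cvg_picone_err oOmega q_gt1 q_lt_p Wphi Wu phi_gt0 u_ge0 C0.
have cre := cvgD cr ce; rewrite -[leRHS]addr0.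
apply: (ler_cvg_to cl (cre _)); apply: nearW => n.
by have [_ _] := hC n.+1%:R (M1 n).
Qed.

End limit_picone.

(** * Nonexistence of solutions positive where a is positive *)

(** The closure of a bounded set is compact. *)
Lemma continuous_closure_bounded {R : realType} {N : nat} (Omega : set 'rV[R]_N)
    (a : 'rV[R]_N -> R) : bounded_set Omega -> {within closure Omega, continuous a} ->
  exists B : R, forall x, Omega x -> `|a x| <= B.
Proof.
move=> [M [_ OM]] ca.
have bcl : bounded_set (closure Omega).
  exists (M + 1); split; first exact: num_real.
  move=> K MK x clx /=; rewrite leNgt; apply/negP => Kx.
  have : \forall y \near x, K < `|y|.
    have /cvgr_gt : (fun y : 'rV[R]_N => `|y|) y @[y --> x] --> `|x|.
      exact: norm_continuous.
    exact.
  move=> /clx[y [Oy]] /=; apply/negP; rewrite -leNgt.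
  by apply: (OM K) => //; rewrite (lt_trans _ MK)// ltrDl.
have cK := bounded_closed_compact bcl (@closed_closure _ Omega).
have /compact_bounded[B [_ hB]] := continuous_compact ca cK.
exists (B + 1) => x Ox; apply: (hB (B + 1)); first by rewrite ltrDl.
by exists x => //; exact: subset_closure.
Qed.

(** A nonnegative function with integral 0 vanishes almost everywhere, but
    nonempty open sets have positive measure. *)
Lemma Rintegral_gt0 {R : realType} {N : nat} (Omega V : set 'rV[R]_N) (K : 'rV[R]_N -> R) :
  measurable Omega -> (lebesgue_rV N).-integrable Omega (EFin \o K) ->
  (forall x, Omega x -> 0 <= K x) -> open V -> V !=set0 -> V `<=` Omega ->
  (forall x, V x -> 0 < K x) -> 0 < \int[lebesgue_rV N]_(x in Omega) K x.
Proof.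
move=> mO iK K0 oV Vn0 VO KV; rewrite lt_neqAle Rintegral_ge0// andbT.
apply/eqP => I0.
have I0' : (\int[lebesgue_rV N]_(x in Omega) `|(EFin \o K) x| = 0)%E.
  rewrite (eq_integral (EFin \o K)); last first.
    by move=> x /set_mem Ox; rewrite gee0_abs// lee_fin K0.
  by rewrite -[LHS]fineK ?integrable_fin_num// -[fine _]/(Rintegral _ _ _) -I0.
have /integrableP[mK _] := iK.
have [Z [mZ Z0 hZ]] := (ae_eq_integral_abs _ mO mK).1 I0'.
have VZ : V `<=` Z.
  move=> x Vx; apply: hZ => /= h; have := KV x Vx.
  by have [->] := h (VO _ Vx); rewrite ltxx.
have := lebesgue_rV_open_gt0 oV Vn0; rewrite ltNge => /negP; apply.
by rewrite -Z0; apply: le_measure => //; rewrite inE//; exact: open_rV_measurable.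
Qed.

Theorem theorem1p21 (R : realType) (N : nat) (hN : (0 < N)%N)
    (Omega : set 'rV[R]_N)
    (Omega_open : open Omega) (Omega_connected : connected Omega)
    (Omega_nonempty : Omega !=set0) (Omega_bounded : bounded_set Omega)
    (Omega_C2 : (1 < N)%N -> C2_boundary Omega)
    (a : 'rV[R]_N -> R) (a_cont : {within closure Omega, continuous a})
    (a_pos : pos_part_dom Omega a !=set0)
    (a_neg : neg_part_dom Omega a !=set0)
    (p q : R) (q_gt1 : 1 < q) (q_lt_p : q < p)
    (pq_cond : forall s : R, 0 <= s ->
      0 <= (q - 1) * s `^ p + q * s `^ (p - 1) - (p - q) * s + (q - p + 1))
    (phi : 'rV[R]_N -> R) (phi_eigen : first_eigenfunction Omega p phi)
    (lambda : R)
    (hlambda :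
      (\int[lebesgue_rV N]_(x in Omega) (a x * phi x `^ q) = 0 /\
       first_eigenvalue Omega p < lambda) \/
      (0 < \int[lebesgue_rV N]_(x in Omega) (a x * phi x `^ q) /\
       first_eigenvalue Omega p <= lambda)) :
  ~ exists u : 'rV[R]_N -> R,
      [/\ solution Omega p q a lambda u,
          exists x, Omega x /\ u x <> 0,
          forall x, Omega x -> 0 <= u x &
          forall x, pos_part_dom Omega a x -> 0 < u x].
Proof.
move=> [u [[[Gu [Wu eq_u]] u_cont] [x0 [Ox0 ux0]] u_ge0 u_pos]].
have [Gphi [Wphi eq_phi phi_cont phi_gt0 _]] := phi_eigen.
have mO := open_rV_measurable Omega_open.
have finO := lebesgue_rV_bounded_lty Omega_bounded mO.
have [Ba aB] := continuous_closure_bounded Omega_bounded a_cont.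
have ma : measurable_fun Omega a.
  apply: continuous_in_measurable => //; rewrite -continuous_open_subspace//.
  exact: continuous_subspaceW (@subset_closure _ Omega) a_cont.
have q0 : 0 < q := lt_trans ltr01 q_gt1.
have p1 : 1 < p := lt_trans q_gt1 q_lt_p.
have p0 : 0 < p := lt_trans ltr01 p1.
have r1 : 0 <= p - 1 by rewrite subr_ge0 ltW.
have r2 : p - 1 <= p by rewrite gerBl.
have r3 : 0 <= q - 1 by rewrite subr_ge0 ltW.
have r4 : q - 1 <= p by rewrite (le_trans _ (ltW q_lt_p))// gerBl.
have iu_pow b B r := @integrable_u_pow _ _ _ p q Omega_open finO q_gt1 q_lt_p
  phi u Gphi Gu Wphi Wu phi_gt0 u_ge0 b B r.
have iphi_pow b B r := @integrable_phi_pow _ _ _ p q Omega_open finO q_gt1 q_lt_p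
  phi u Gphi Gu Wphi Wu phi_gt0 u_ge0 b B r.
pose lam1 := first_eigenvalue Omega p.
have test_bm w : test_function Omega w -> measurable_fun Omega w /\
    exists B, forall x, `|w x| <= B.
  move=> tw; split; first by apply: continuous_rV_measurable_on; exact: test_function_continuous tw.
  by have [B [hB _]] := test_function_bounded tw; exists B.
have weak_phi w : test_function Omega w -> plaplace_form Omega p Gphi (grad w) =
    \int[lebesgue_rV N]_(x in Omega) (source_phi p phi lam1 x * w x).
  move=> tw; have [mw [B wB]] := test_bm w tw.
  rewrite (eq_phi _ _ (test_function_W01p Omega_open finO p1 tw)) -/lam1.
  rewrite (@eq_Rintegral _ _ _ _ _ (fun x => w x * phi x `^ (p - 1))); last first.
    move=> x /set_mem Ox; rewrite (abs_powR_mul p1 (ltW (phi_gt0 _ Ox))).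
    by rewrite mulrC.
  rewrite -RintegralZl//; last exact: (iphi_pow w B).
  by apply: eq_Rintegral => x _; rewrite /source_phi; ring.
have weak_u w : test_function Omega w -> plaplace_form Omega p Gu (grad w) =
    \int[lebesgue_rV N]_(x in Omega) (source_u p q a u lambda x * w x).
  move=> tw; have [mw [B wB]] := test_bm w tw.
  rewrite (eq_u _ _ (test_function_W01p Omega_open finO p1 tw)).
  rewrite (@eq_Rintegral _ _ _ _ _ (fun x => w x * u x `^ (p - 1))); last first.
    by move=> x /set_mem Ox; rewrite (abs_powR_mul p1 (u_ge0 _ Ox)) mulrC.
  rewrite (@eq_Rintegral _ _ _ _ _ (fun x => (a x * w x) * u x `^ (q - 1))
    (fun x => a x * _ * _ * _)); last first.
    by move=> x /set_mem Ox; rewrite -(abs_powR_mul q_gt1 (u_ge0 _ Ox)); ring.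
  have i1 : (lebesgue_rV N).-integrable Omega (EFin \o (fun x => w x * u x `^ (p - 1))).
    exact: (iu_pow w B).
  have i2 : (lebesgue_rV N).-integrable Omega
      (EFin \o (fun x => (a x * w x) * u x `^ (q - 1))).
    apply: (iu_pow _ (Ba * B)) => //; first exact: measurable_funM.
    by move=> x Ox; rewrite normrM ler_pM// aB.
  rewrite -RintegralZl// -RintegralD//; last exact: (integrableZl mO lambda i1).
  by apply: eq_Rintegral => x _; rewrite /source_u; ring.
have main := limit_picone Omega_open finO q_gt1 q_lt_p pq_cond Wphi Wu phi_gt0 u_ge0
  ma aB weak_phi weak_u.
have [il _] := cvg_picone_lhs Omega_open finO q_gt1 q_lt_p lambda Wphi Wu phi_gt0 u_ge0 ma aB.
pose K x := u x `^ (p - q) * phi x `^ q.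
have [mphi _ _ _] := W01p_measurable_integrable mO p0 Wphi.
have [mu' _ _ _] := W01p_measurable_integrable mO p0 Wu.
have mpow (f : 'rV[R]_N -> R) r : measurable_fun Omega f -> measurable_fun Omega (fun x => f x `^ r).
  by move=> mf; exact: (@measurableT_comp _ _ _ _ _ _ (fun x => x `^ r)).
have K0 x : Omega x -> 0 <= K x by move=> _; rewrite mulr_ge0 ?powR_ge0.
have iK : (lebesgue_rV N).-integrable Omega (EFin \o K).
  apply: (integrable_dominated mO (g := fun x => envelope phi u x `^ p)).
  - by apply: measurable_funM; exact: mpow.
  - exact: (integrable_envelope Omega_open finO q_gt1 q_lt_p Wphi Wu phi_gt0 u_ge0).
  - move=> x Ox; rewrite ger0_norm ?K0//.
    have [W1 W0 uW phiW] := envelope_ge phi_gt0 u_ge0 Ox.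
    rewrite (_ : envelope phi u x `^ p = envelope phi u x `^ (p - q) * envelope phi u x `^ q).
      apply: ler_pM; rewrite ?powR_ge0// ge0_ler_powR ?nnegrE ?(ltW W0) ?u_ge0//.
      + by rewrite subr_ge0 ltW.
      + exact: ltW.
      + exact/ltW/phi_gt0.
    by rewrite -powRD ?subrK// (gt_eqF W0) implybT.
have ia : (lebesgue_rV N).-integrable Omega (EFin \o (fun x => a x * phi x `^ q)).
  by apply: (iphi_pow a Ba) => //; exact: ltW.
(* Where u vanishes, a <= 0; elsewhere the integrands agree. *)
have lower : lambda * (\int[lebesgue_rV N]_(x in Omega) K x) +
    \int[lebesgue_rV N]_(x in Omega) (a x * phi x `^ q) <=
    \int[lebesgue_rV N]_(x in Omega) limit_lhs p q a phi u lambda x.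
  have iZ : (lebesgue_rV N).-integrable Omega (EFin \o (fun x => lambda * K x)).
    exact: (integrableZl mO lambda iK).
  rewrite -(RintegralZl lambda mO iK) -(RintegralD mO iZ ia).
  apply: (le_Rintegral mO (integrableD mO iZ ia) il).
  move=> x Ox; rewrite /limit_lhs /source_u /K.
  have [ux|ux] := eqVneq (u x) 0.
    have z r : 0 < r -> (0 : R) `^ r = 0 by move=> r0; rewrite powR0// gt_eqF.
    rewrite ux (z (p - q)) ?subr_gt0// (z (p - 1)) ?subr_gt0// (z (q - 1)) ?subr_gt0//.
    rewrite !(mul0r, mulr0, add0r) mulr_le0_ge0 ?powR_ge0// leNgt; apply/negP => ax.
    by have := u_pos x (conj Ox ax); rewrite ux ltxx.
  have ux_gt0 : 0 < u x by rewrite lt_neqAle eq_sym ux u_ge0.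
  have D r r' : u x `^ (r + r') = u x `^ r * u x `^ r' by rewrite powRD// ux implybT.
  have -> : u x `^ (p - q) = u x `^ (p - 1) * u x `^ (1 - q).
    by rewrite -D; congr powR; ring.
  have : u x `^ (q - 1) * u x `^ (1 - q) = 1.
    by rewrite -D (_ : q - 1 + (1 - q) = 0) ?powRr0//; ring.
  move: (u x `^ (q - 1)) (u x `^ (1 - q)) (u x `^ (p - 1)) (phi x `^ q) => b b' c d bb'.
  rewrite [leRHS](_ : _ = lambda * (c * b' * d) + a x * d * (b * b')); last by ring.
  by rewrite bb' mulr1.
have upper : \int[lebesgue_rV N]_(x in Omega) limit_rhs p q phi u lam1 x =
    lam1 * \int[lebesgue_rV N]_(x in Omega) K x.
  rewrite -(RintegralZl lam1 mO iK); apply: eq_Rintegral => x /set_mem Ox.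
  rewrite /limit_rhs /source_phi /K.
  have -> : phi x `^ q = phi x `^ (p - 1) * phi x `^ (q - p + 1).
    rewrite -powRD ?(gt_eqF (phi_gt0 _ Ox)) ?implybT//; congr powR; ring.
  ring.
rewrite upper in main; have {main lower upper} fin := le_trans lower main.
have IK0 : 0 <= \int[lebesgue_rV N]_(x in Omega) K x by exact: Rintegral_ge0.
case: hlambda => [[I0 lam_gt]|[I0 lam_ge]].
- have IK : 0 < \int[lebesgue_rV N]_(x in Omega) K x.
    apply: (@Rintegral_gt0 _ _ _ [set x | Omega x /\ 0 < u x]) => //.
    + rewrite openE => x [Ox ux]; apply: filterI.
        exact: (open_nbhs_nbhs (conj Omega_open Ox)).
      by have /cvgr_gt := u_cont x Ox; apply.
    + by exists x0; split => //; rewrite lt_neqAle u_ge0// andbT eq_sym; apply/eqP.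
    + by move=> x [].
    + by move=> x [Ox ux]; rewrite mulr_gt0 ?powR_gt0 ?phi_gt0.
  rewrite I0 addr0 ler_pM2r// in fin.
  by move: lam_gt; rewrite ltNge fin.
- have : lam1 * (\int[lebesgue_rV N]_(x in Omega) K x) <=
     lambda * (\int[lebesgue_rV N]_(x in Omega) K x) by rewrite ler_wpM2r.
  by move=> h; have := le_trans fin h; rewrite gerDl leNgt I0.
Qed.
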